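(* Let $M$ be a complex manifold of dimension $n$ and let $G_1$ and $G_2$ be two complex Finsler metrics on $M$. For any point $(z,[v])\in P(TM)$ one has $$\frac{2}{G_2(z,v)}\,\sup_{\pi_*(X)=v}\left\{\Big(\partial\bar\partial\log\frac{G_1}{G_2}\Big)(X,\overline{X})\right\}\;\ge\; K_{G_2}(z,[v])-\frac{G_1(z,v)}{G_2(z,v)}\,K_{G_1}(z,[v]),$$ where $\pi_*:T(TM)\to TM$ is the differential of the projection $\pi:TM\to M$, and the supremum is over all $X\in T_{(z,v)}(TM)$ (holomorphic tangent vectors of the complex manifold $TM$ at $(z,v)$) with $\pi_*(X)=v$.
   Context: $\pi:TM\to M$ is the holomorphic tangent bundle of $M$, $(TM)^o=TM\setminus O$ is the complement of the zero section, and $P(TM)=(TM)^o/\mathbb{C}^*$ is its projectivization, with points written $(z,[v])$. $T(TM)$ denotes the holomorphic (type $(1,0)$) tangent bundle of the complex manifold $TM$. A complex Finsler metric on $M$ is a continuous function $G:TM\to\mathbb{R}$ such that: (F1) $G$ is smooth on $(TM)^o$; (F2) $G(z,v)\ge 0$, with $G(z,v)=0$ if and only if $v=0$; (F3) $G(z,\lambda v)=|\lambda|^2G(z,v)$ for all $\lambda\in\mathbb{C}$. (No pseudoconvexity is assumed.) Holomorphic sectional curvature: let $\Delta=\{w\in\mathbb{C}:|w|<1\}$. For a holomorphic map $\varphi:\Delta\to M$ put $(\varphi^*G)(w)=G(\varphi_*(\partial/\partial w))$; where this is positive, the Gaussian curvature of the conformal metric $\varphi^*G\,dw\otimes d\bar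 w$ is $$K_{\varphi^*G}=-\frac{2}{\varphi^*G}\,\frac{\partial^2\log\varphi^*G}{\partial w\,\partial\bar w}.$$ The holomorphic sectional curvature of $G$ at $(z,[v])\in P(TM)$ is $K_G(z,[v])=\sup_\varphi K_{\varphi^*G}(0)$, the supremum being over all holomorphic $\varphi:\Delta\to M$ with $\varphi(0)=z$ and $\varphi'(0)=\lambda v$ for some $\lambda\in\mathbb{C}^*$. Conventions: for a smooth function $f$ on a complex manifold with local coordinates $(x^a)$ and a $(1,0)$-vector $X=X^a\partial/\partial x^a$, $(\partial\bar\partial f)(X,\overline X)=\frac{\partial^2 f}{\partial x^a\partial\bar x^b}X^a\overline{X^b}$. The quotient $G_1/G_2$ is regarded as a smooth function on $(TM)^o$ (it is invariant under $v\mapsto\lambda v$). Suprema are taken in the extended reals, so $K_G$ may equal $+\infty$; the inequality is asserted whenever the right-hand side is defined (not of the form $\infty-\infty$). *)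

(* Defs.v *)
From HB Require Import structures.
From mathcomp Require Import all_boot all_order all_algebra.
From mathcomp Require Import complex.
From mathcomp Require Import all_classical all_reals all_analysis.
Import Order.TTheory GRing.Theory Num.Theory numFieldNormedType.Exports.

Set Implicit Arguments.
Unset Strict Implicit.
Unset Printing Implicit Defensive.

Local Open Scope classical_set_scope.
Local Open Scope ring_scope.
Local Open Scope complex_scope.

(* C^n with its norm; the type inference of Rocq does not find the topology of
   'rV[R[i]]_n by itself. *)
Definition Cn (R : realType) (n : nat) : normedModType R[i] := 'rV[R[i]]_n.

Section Calculus.
Context {R : realType} {V : normedModType R[i]}.

(* Derivative at x along the real line t |-> x + t h.  As V is a complex space,
   h ranges over all real directions: along 'i *: h one differentiates in the
   imaginary part of the h-coordinate. *)
Definition rderive (h : V) (f : V -> R) (x : V) : R :=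
  derive1 (fun t : R => f (x + t%:C *: h)) 0.

(* In the definitions below U is open in all uses. *)
Definition continuous_in (U : set V) (f : V -> R) : Prop :=
  forall x, U x -> {for x, continuous f}.

Fixpoint Ck (k : nat) (U : set V) (f : V -> R) : Prop :=
  continuous_in U f /\
  (if k is k'.+1 then
     forall h : V,
       (forall x, U x -> derivable (fun t : R => f (x + t%:C *: h)) 0 1) /\
       Ck k' U (rderive h f)
   else True).

Definition smooth (U : set V) (f : V -> R) : Prop := forall k, Ck k U f.

(* The definition of Griffiths-Harris: a C^oo map satisfying the
   Cauchy-Riemann equations.  These are stated as differentiability over the
   field R[i], i.e. complex linearity of the differential. *)
Definition holomorphic m (U : set V) (f : V -> 'rV[R[i]]_m) : Prop :=
  (forall x, U x -> differentiable f x) /\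
  (forall j, smooth U (fun x => complex.Re (f x 0 j)) /\
             smooth U (fun x => complex.Im (f x 0 j))).

Definition differential (W : normedModType R[i]) (f : V -> W) (x h : V) : W :=
  'd f x h.

Definition cderive (h : V) (f : V -> R[i]) (x : V) : R[i] :=
  rderive h (fun y => complex.Re (f y)) x
  +i* rderive h (fun y => complex.Im (f y)) x.

(* d/dz = (d/ds - i d/dt) / 2 and d/dzbar = (d/ds + i d/dt) / 2, where
   z = s + i t is the complex coordinate along the direction h. *)
Definition wirt (h : V) (f : V -> R[i]) (x : V) : R[i] :=
  2^-1 * (cderive h f x - 'i * cderive ('i *: h) f x).

Definition wirtbar (h : V) (f : V -> R[i]) (x : V) : R[i] :=
  2^-1 * (cderive h f x + 'i * cderive ('i *: h) f x).

End Calculus.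

(* (d dbar u)(X, Xbar) at x, for u defined near x in C^N.  The sum is a real
   number because u is real-valued; Re only changes its type. *)
Definition levi_coord {R : realType} {N : nat} (u : 'rV[R[i]]_N -> R)
    (x X : 'rV[R[i]]_N) : R :=
  complex.Re (\sum_(a < N) \sum_(b < N)
        wirt (delta_mx 0 a) (wirtbar (delta_mx 0 b) (fun y => (u y)%:C)) x
        * X 0 a * (X 0 b)^*).

(* A family of C^n-valued charts, given by their domains and coordinate maps;
   the value of coord i outside dom i is irrelevant. *)
Record atlas (R : realType) (n : nat) (T : Type) := Atlas {
  idx : Type;
  dom : idx -> set T;
  coord : idx -> T -> 'rV[R[i]]_n }.

Section Atlas.
Context {R : realType} {n : nat} {T : Type} (A : atlas R n T).

(* The expression of f in the chart i: the map f \o (coord i)^-1 on the image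
   of the chart, extended by 0. *)
Definition localize {Y : zmodType} (i : idx A) (f : T -> Y)
    (x : 'rV[R[i]]_n) : Y :=
  xget 0 [set y | exists p, [/\ dom i p, coord i p = x & f p = y]].

Definition continuous_on (f : T -> R) : Prop :=
  forall i, continuous_in (coord i @` dom i) (localize i f).

Definition smooth_on (S : set T) (f : T -> R) : Prop :=
  forall i, smooth (coord i @` (dom i `&` S)) (localize i f).

(* A (1,0)-tangent vector at p is the family of its components v i in the
   charts i around p, which transform by the differentials of the coordinate
   changes.  The components in the other charts are set to 0 so that a tangent
   vector is represented by exactly one family. *)
Definition tangent_at (p : T) (v : idx A -> 'rV[R[i]]_n) : Prop :=
  (forall i j, dom i p -> dom j p ->
     v j = differential (localize i (coord j)) (coord i p) (v i)) /\
  (forall i, ~ dom i p -> v i = 0).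

Record tangent_bundle := TangentVector {
  tpt : T;
  tcomp : idx A -> 'rV[R[i]]_n;
  tangentP : tangent_at tpt tcomp }.

Definition is_zero (p : tangent_bundle) : Prop := forall i, tcomp p i = 0.

Lemma tangent_atZ (l : R[i]) p v :
  tangent_at p v -> tangent_at p (fun i => l *: v i).
Proof.
move=> [vJ v0]; split=> [i j ip jp|i ip]; last by rewrite v0 ?scaler0.
by rewrite /differential linearZ /= (vJ i j).
Qed.

Definition tscale (l : R[i]) (p : tangent_bundle) : tangent_bundle :=
  TangentVector (tangent_atZ l (tangentP p)).

(* The charts (z, v) |-> (coord i z, v i) of the holomorphic tangent bundle. *)
Definition tangent_atlas : atlas R (n + n) tangent_bundle :=
  {| idx := idx A;
     dom := fun i => [set p | dom i (tpt p)];
     coord := fun i p => row_mx (coord i (tpt p)) (tcomp p i) |}.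

(* (d dbar f)(X, Xbar); its value does not depend on the chart around the base
   point of X in which it is computed. *)
Definition levi (f : T -> R) (X : tangent_bundle) : R :=
  xget 0 [set levi_coord (localize i f) (coord i (tpt X)) (tcomp X i)
         | i in [set i | dom i (tpt X)]].

(* p = phi_*(d/dw) at the point w. *)
Definition is_velocity (phi : R[i]^o -> T) (w : R[i]^o)
    (p : tangent_bundle) : Prop :=
  tpt p = phi w /\
  forall i, dom i (phi w) -> tcomp p i = derive1 (coord i \o phi) w.

(* (phi^* G)(w) = G (phi_*(d/dw)); when phi is holomorphic near w there is
   exactly one velocity vector at w. *)
Definition pullback (G : tangent_bundle -> R) (phi : R[i]^o -> T)
    (w : R[i]^o) : R :=
  xget 0 [set G p | p in is_velocity phi w].

End Atlas.

(* Y = f_*(X).  For f holomorphic at the base point of X, this determines Y. *)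
Definition is_pushforward {R : realType} {n m : nat} {S T : Type}
    {A : atlas R n S} {B : atlas R m T} (f : S -> T)
    (X : tangent_bundle A) (Y : tangent_bundle B) : Prop :=
  tpt Y = f (tpt X) /\
  forall (i : idx A) (j : idx B), dom i (tpt X) -> dom j (f (tpt X)) ->
    tcomp Y j =
      differential (localize i (coord j \o f)) (coord i (tpt X)) (tcomp X i).

Record complex_manifold (R : realType) (n : nat) := ComplexManifold {
  space :> topologicalType;
  space_hausdorff : hausdorff_space space;
  space_second_countable : @second_countable space;
  charts : atlas R n space;
  dom_open : forall i : idx charts, open (dom i);
  dom_cover : forall p : space, exists i : idx charts, dom i p;
  coord_inj : forall i : idx charts, {in dom i &, injective (coord i)};
  coord_continuous : forall (i : idx charts) p,
    dom i p -> {for p, continuous (coord i : space -> Cn R n)};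
  coord_open : forall (i : idx charts) (W : set space),
    open W -> W `<=` dom i -> open (coord i @` W : set (Cn R n));
  coord_change : forall i j : idx charts,
    holomorphic (coord i @` (dom i `&` dom j)) (localize i (coord j)) }.

Section Finsler.
Context {R : realType} {n : nat} (M : complex_manifold R n).

Definition TM : Type := tangent_bundle (charts M).

Definition TTM : Type := tangent_bundle (tangent_atlas (charts M)).

Record complex_finsler (G : TM -> R) : Prop := ComplexFinsler {
  finsler_continuous : continuous_on (tangent_atlas (charts M)) G;
  finsler_smooth :
    smooth_on (tangent_atlas (charts M)) [set p | ~ is_zero p] G;
  finsler_ge0 : forall p, 0 <= G p;
  finsler_eq0 : forall p, G p = 0 <-> is_zero p;
  finsler_homogeneous : forall (l : R[i]) p,
    (G (tscale l p))%:C = `|l| ^+ 2 * (G p)%:C }.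

Definition unit_disc : set R[i]^o := [set w | `|w| < 1].

(* Only the restriction of phi to the unit disc matters. *)
Definition holomorphic_disc (phi : R[i]^o -> M) : Prop :=
  (forall w, unit_disc w -> {for w, continuous phi}) /\
  (forall i : idx (charts M),
     holomorphic (unit_disc `&` phi @^-1` dom i) (coord i \o phi)).

(* Gaussian curvature at w of the conformal metric g dw (x) dwbar. *)
Definition gauss_curvature (g : R[i]^o -> R) (w : R[i]^o) : R :=
  - (2 / g w) *
  complex.Re
    (wirt (1 : R[i]^o) (wirtbar (1 : R[i]^o) (fun x => (ln (g x))%:C)) w).

Definition holomorphic_disc_through (p : TM) (phi : R[i]^o -> M) : Prop :=
  [/\ holomorphic_disc phi, phi 0 = tpt p &
      exists2 l : R[i], l != 0 & is_velocity phi 0 (tscale l p)].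

(* K_G(z,[v]) for p = (z,v), v <> 0; it is invariant under scaling of v. *)
Definition hol_sect_curvature (G : TM -> R) (p : TM) : \bar R :=
  ereal_sup [set (gauss_curvature (pullback G phi) 0)%:E
            | phi in holomorphic_disc_through p].

End Finsler.

(* Main.v *)
(* For a disc phi with phi(0) = z and phi'(0) = l v, the lift
   c(w) = (phi(w), phi'(w) / l) passes through (z, v), and by homogeneity
   ln (phi^* G) = ln (|l|^2 G) o c for both metrics.  Hence the Laplacian at 0
   of ln (phi^* G1) - ln (phi^* G2) is the Levi form of ln (G1 / G2) on c'(0),
   and X = c'(0) / l projects to v.  This gives the exact identity
     (2 / G2) levi (ln (G1 / G2)) X
       = K_{phi^* G2}(0) - (G1 / G2) K_{phi^* G1}(0),
   from which the inequality follows by taking suprema over phi.  That X is a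
   tangent vector of TM requires the coordinate changes of TM to be complex
   differentiable; this is the symmetry of second derivatives applied to the
   Cauchy-Riemann equations. *)

Require Import Defs.
From HB Require Import structures.
From mathcomp Require Import all_boot all_order all_algebra.
From mathcomp Require Import complex.
From mathcomp Require Import all_classical all_reals all_analysis.
From mathcomp Require Import ring lra.
Import Order.TTheory GRing.Theory Num.Theory numFieldNormedType.Exports.

Set Implicit Arguments.
Unset Strict Implicit.
Unset Printing Implicit Defensive.

Local Open Scope classical_set_scope.
Local Open Scope ring_scope.
Local Open Scope complex_scope.

(** * Directional derivatives *)

(** [Ck] only provides continuous derivatives along real lines, while ['d] is the differential over
    [R[i]]. Neither linearity of [rderive] in its direction nor a chain rule comes with the
    definitions; both are derived from the mean value theorem on paths that change one real
    coordinate at a time. Why the Laplacian along a holomorphic c sees only c': the second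
    derivative of u o c in the direction h is Hess u (c'h, c'h) + du (c''(h, h)). Since c'' is
    complex bilinear, c''(ih, ih) = - c''(h, h), so adding the directions h and ih removes c''. What
    remains, Hess u (X, X) + Hess u (iX, iX) with X = c'h, is four times the Levi form at X. In the
    passage to suprema the curvature of G1 is first moved to the right-hand side of the identity of
    each disc, where it is bounded by its supremum; infinite values of K_{G1} are treated
    separately. *)

Section RealDirections.
Context {R : realType} {V : normedModType R[i]}.
Implicit Types (x y h k : V) (W : set V).

Lemma real_complex_continuous : continuous (fun t : R => t%:C : R[i]^o).
Proof.
move=> t; apply/cvgrPdist_lt => e e0.
have er : (complex.Re e)%:C = e by rewrite RRe_real // gtr0_real.
near=> s.
rewrite -rmorphB /= normc_def /= expr0n /= addr0 sqrtr_sqr -er ltcR.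
near: s; apply: cvgr_dist_lt => //.
by rewrite -ltcR er.
Unshelve. all: by end_near. Qed.

Lemma line_continuous x h : continuous (fun t : R => x + t%:C *: h).
Proof.
move=> t; apply: cvgD; first exact: cvg_cst.
by apply: (@cvgZr_tmp R[i] V); exact: real_complex_continuous.
Qed.

(** [rderive] differentiates at the parameter 0 only. Moving the base point along the line reaches
    every parameter [s], as the mean value theorem requires. *)
Lemma is_derive_line (f : V -> R) x h s :
  derivable (fun t : R => f (x + s%:C *: h + t%:C *: h)) 0 1 ->
  is_derive s 1 (fun t : R => f (x + t%:C *: h)) (rderive h f (x + s%:C *: h)).
Proof.
have E t : (fun t : R => f (x + s%:C *: h + t%:C *: h)) (t *: 1 + 0) =
  (fun t : R => f (x + t%:C *: h)) (t *: 1 + s).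
  by rewrite addr0 [t *: 1]mulr1 rmorphD /= scalerDl [t%:C *: _ + _]addrC addrA.
have E0 : (fun t : R => f (x + s%:C *: h + t%:C *: h)) 0 = f (x + s%:C *: h).
  by rewrite rmorph0 scale0r addr0.
have EQ : (fun t : R => t^-1 *: ((fun t : R => f (x + s%:C *: h + t%:C *: h))
  (t *: 1 + 0) - f (x + s%:C *: h + 0%:C *: h))) = (fun t : R => t^-1 *:
  ((fun t : R => f (x + t%:C *: h)) (t *: 1 + s) - f (x + s%:C *: h))).
  by apply/funext => t; rewrite E E0.
move=> df; split; first by move: df; rewrite /derivable EQ.
by rewrite /rderive derive1E /derive EQ.
Qed.

(** The gap at [s = 0] is filled with the derivative at the limit point [x], not at [y]: the
    factorization of the increment then holds for every [s], and the limit as [y] tends to [x] is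
    not disturbed. *)
Definition partial_quotient k (f : V -> R) x y (s : R) : R :=
  if s == 0 then rderive k f x else (f (y + s%:C *: k) - f y) / s.

Lemma partial_quotientE k f x y s :
  f (y + s%:C *: k) - f y = s * partial_quotient k f x y s.
Proof.
rewrite /partial_quotient; case: eqVneq => [->|s0].
  by rewrite rmorph0 scale0r addr0 subrr mul0r.
by rewrite mulrC divfK.
Qed.

(** The step [s] is signed, so [MVT_segment] is used on [0, s] or on [s, 0] according to its
    sign. *)
Lemma partial_mvt k (f : V -> R) y (s : R) :
  (forall t : R, `|t| <= `|s| -> derivable (fun t' : R =>
    f (y + t%:C *: k + t'%:C *: k)) 0 1) ->
  exists2 c : R, `|c| <= `|s| & f (y + s%:C *: k) - f y = rderive k f
    (y + c%:C *: k) * s.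
Proof.
move=> df.
pose g t := f (y + t%:C *: k).
have dg (t : R) : `|t| <= `|s| -> is_derive t 1 g (rderive k f (y + t%:C *: k)).
  by move=> /df /is_derive_line.
have g0 : g 0 = f y by rewrite /g rmorph0 scale0r addr0.
have gc (a b : R) : `|a| <= `|s| -> `|b| <= `|s| ->
  {within `[a, b], continuous g}.
  move=> sa sb; apply: derivable_within_continuous => t; rewrite in_itv /= =>
    /andP[at_ tb].
  have /dg[] // : `|t| <= `|s|.
  by move: sa sb; rewrite !ler_norml => /andP[? ?] /andP[? ?]; apply/andP;
    split; lra.
have [s0|s0] := leP 0 s.
  have := @MVT_segment R g (fun t => rderive k f (y + t%:C *: k)) 0 s s0.
  case.
  - move=> t; rewrite in_itv /= => /andP[t0 ts]; apply: dg.
    by rewrite !ger0_norm // ltW.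
  - by apply: gc; rewrite ?normr0.
  move=> c; rewrite in_itv /= => /andP[c0 cs]; rewrite g0 subr0 => e.
  by exists c; first by rewrite !ger0_norm.
have := @MVT_segment R g (fun t => rderive k f (y + t%:C *: k)) s 0 (ltW s0).
case.
- move=> t; rewrite in_itv /= => /andP[t0 ts]; apply: dg.
  by rewrite !ltr0_norm // lerN2 ltW.
- by apply: gc; rewrite ?normr0.
move=> c; rewrite in_itv /= => /andP[c0 cs]; rewrite g0 sub0r => e.
exists c; first by rewrite !ler0_norm ?lerN2 // ltW.
by rewrite -opprB e mulrN opprK.
Qed.

(** Joint continuity of (y, t) |-> y + t k at (x, 0) yields a radius [d] that is uniform in [y]. *)
Lemma near_translates k x (P : set V) : (\near x, P x) ->
  exists2 d : R, 0 < d & \forall y \near x, forall t : R, `|t| < d ->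
    P (y + t%:C *: k).
Proof.
move=> Px.
have : \forall z \near (x, 0 : R), P (z.1 + z.2%:C *: k).
  have : (fun z : V * R => z.1 + z.2%:C *: k) @ (x, 0 : R) --> x.
    rewrite -[X in _ --> X]addr0 -[X in _ + X](scale0r k); apply: cvgD;
      first exact: cvg_fst.
    apply: (@cvgZr_tmp R[i] V); rewrite -(rmorph0 (real_complex R)).
    by apply: continuous_comp; [exact: cvg_snd|exact: real_complex_continuous].
  by apply; exact: Px.
move=> [[A B] /= [Ax /nbhs_ballP[d /= d0 dB]] AB].
exists d => //; near=> y => t td.
apply: (AB (y, t)); split => /=; first by near: y.
by apply: dB; rewrite /ball /= sub0r normrN.
Unshelve. all: by end_near. Qed.

(** By the mean value theorem the quotient is a derivative at a point between [y] and [y + s k],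
    which is close to [x]; continuity of [rderive k f] concludes. *)
Lemma cvg_partial_quotient (T : Type) (F : set_system T) (FF : Filter F)
    k (f : V -> R) x (y : T -> V) (s : T -> R) :
  (\forall z \near x, derivable (fun t : R => f (z + t%:C *: k)) 0 1) ->
  {for x, continuous (rderive k f)} ->
  y @ F --> x -> s @ F --> 0 ->
  partial_quotient k f x (y t) (s t) @[t --> F] --> rderive k f x.
Proof.
move=> df cf yx s0; apply/cvgrPdist_le => e e0.
have : \forall z \near x, derivable (fun t : R => f (z + t%:C *: k)) 0 1 /\
    `|rderive k f x - rderive k f z| <= e.
  have /cvgrPdist_le/(_ e e0) cfe : rderive k f z @[z --> x] -->
    rderive k f x := cf.
  by near=> z; split; near: z.
move=> /(near_translates k)[d d0 H].
have sd : \forall t \near F, `|s t| < d by apply: cvgr0_norm_lt.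
have yH := yx _ H.
near=> t; rewrite /partial_quotient; case: eqVneq => [_|st0].
  by rewrite subrr normr0 ltW.
have std : `|s t| < d by near: t.
have {}H : forall a : R, `|a| < d ->
  derivable (fun t' : R => f (y t + a%:C *: k + t'%:C *: k)) 0 1 /\
    `|rderive k f x - rderive k f (y t + a%:C *: k)| <= e.
  by near: t.
have [a ha ->] := @partial_mvt k f (y t) (s t) (fun a ha =>
  (H a (le_lt_trans ha std)).1).
by rewrite mulfK //; have [] := H a (le_lt_trans ha std).
Unshelve. all: by end_near. Qed.

End RealDirections.

Lemma cvg_sumr (K : numFieldType) (V : normedModType K) (T : Type)
    (F : set_system T) (FF : Filter F) (I : Type) (r : seq I) (P : pred I)
    (f : I -> T -> V) (l : I -> V) :
  (forall i, P i -> f i t @[t --> F] --> l i) ->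
  \sum_(i <- r | P i) f i t @[t --> F] --> \sum_(i <- r | P i) l i.
Proof.
move=> fl; elim: r => [|i r IH].
  by under eq_fun do rewrite big_nil; rewrite big_nil; exact: cvg_cst.
under eq_fun do rewrite big_cons; rewrite big_cons.
by case: ifP => // Pi; apply: cvgD => //; exact: fl.
Qed.

Section Frames.
Context {R : realType} {V : normedModType R[i]}.
Implicit Types (x y h k : V) (W : set V) (f : V -> R).

Lemma Ck_continuous n W f : Ck n W f -> continuous_in W f.
Proof. by case: n => [[]|n []]. Qed.

Lemma Ck_derivable n W f h x : Ck n.+1 W f -> W x ->
  derivable (fun t : R => f (x + t%:C *: h)) 0 1.
Proof. by move=> [_ /(_ h)[df _]] /df. Qed.

Lemma Ck_rderive n W f h : Ck n.+1 W f -> Ck n W (rderive h f).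
Proof. by move=> [_ /(_ h)[]]. Qed.

Lemma CkW n W f : Ck n.+1 W f -> Ck n W f.
Proof.
elim: n f => [|n IH] f [cf df]; first by split.
split=> // h; have [? ?] := df h; split=> //; exact: IH.
Qed.

Lemma is_derive_rderive f x h : derivable (fun t : R =>
  f (x + t%:C *: h)) 0 1 ->
  is_derive (0 : R) 1 (fun t : R => f (x + t%:C *: h)) (rderive h f x).
Proof. by move=> df; rewrite /rderive derive1E; exact: derivableP. Qed.

Lemma rderive_val f x h d : is_derive (0 : R) 1 (fun t : R =>
  f (x + t%:C *: h)) d ->
  rderive h f x = d.
Proof. by move=> df; rewrite /rderive derive1E derive_val. Qed.

(** The mean value theorem is used twice: along [h] for the increment y |-> f (y + s k) - f y, then
    along [k] for [rderive h f]. *)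
Lemma second_difference f x h k (s : R) :
  (forall t t' : R, `|t| <= `|s| -> `|t'| <= `|s| ->
     derivable (fun u : R => f (x + t%:C *: h + t'%:C *: k + u%:C *: h)) 0 1 /\
     derivable (fun u : R => rderive h f (x + t%:C *: h + t'%:C *: k + u%:C *:
       k)) 0 1) ->
  exists t t' : R, [/\ `|t| <= `|s|, `|t'| <= `|s| &
    f (x + s%:C *: h + s%:C *: k) - f (x + s%:C *: h) -
      (f (x + s%:C *: k) - f x)
    = rderive k (rderive h f) (x + t%:C *: h + t'%:C *: k) * s * s].
Proof.
move=> df.
have s00 : `|0 : R| <= `|s| by rewrite normr0.
pose g y := f (y + s%:C *: k) - f y.
have dg (t : R) : `|t| <= `|s| ->
  is_derive (0 : R) 1 (fun u : R => g (x + t%:C *: h + u%:C *: h))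
    (rderive h f (x + t%:C *: h + s%:C *: k) - rderive h f (x + t%:C *: h)).
  move=> ts; rewrite /g; apply: is_deriveB.
    have [/is_derive_rderive + _] := df t s ts (lexx _).
    by under eq_fun do rewrite addrAC.
  have [/is_derive_rderive + _] := df t 0 ts s00.
  by rewrite rmorph0 scale0r addr0.
have [|t ts gE] := @partial_mvt R V h g x s; first by move=> t /dg[].
have [|t' ts' hE] := @partial_mvt R V k (rderive h f) (x + t%:C *: h) s.
  by move=> t' ts'; have [] := df t t' ts ts'.
exists t, t'; split=> //.
by rewrite -hE -(rderive_val (dg _ ts)) -gE.
Qed.

(** The second difference is symmetric in [h] and [k]. Expanding it in both orders makes the two
    mixed derivatives agree at two points near [x], and continuity brings both points back to
    [x]. *)
Lemma rderiveC W f x h k : open W -> W x -> Ck 2 W f ->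
  rderive k (rderive h f) x = rderive h (rderive k f) x.
Proof.
move=> oW Wx Cf.
apply/eqP; rewrite -subr_eq0 -normr_le0; apply/ler_addgt0Pl => e e0;
  rewrite addr0.
have e20 : 0 < e / 2 by rewrite divr_gt0.
have cD a b : \forall y \near x, `|rderive a (rderive b f) x - rderive a
  (rderive b f) y| <= e / 2.
  have C0 := Ck_rderive a (Ck_rderive b Cf).
  have /cvgrPdist_le/(_ _ e20) // : rderive a (rderive b f) z @[z --> x] -->
    rderive a (rderive b f) x := Ck_continuous C0 Wx.
have near_good : \forall y \near x, [/\ W y,
   `|rderive k (rderive h f) x - rderive k (rderive h f) y| <= e / 2 &
   `|rderive h (rderive k f) x - rderive h (rderive k f) y| <= e / 2].
  have nW : \forall y \near x, W y by exact: open_nbhs_nbhs (conj oW Wx).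
  by apply: filterS3 nW (cD k h) (cD h k).
have [d1 d10 /(near_translates h)[d2 d20 /nbhs_singleton H]] :=
  near_translates k near_good.
(* [d1] bounds the steps along [k] and [d2] those along [h]. Half of the minimum keeps all steps of
   size at most [s] strictly inside both bounds. *)
pose s := Num.min d1 d2 / 2.
have m0 : 0 < Num.min d1 d2 by rewrite lt_min d10.
have s0 : 0 < s by rewrite divr_gt0.
have sm : s < Num.min d1 d2 by rewrite ltr_pdivrMr // ltr_pMr // ltr1n.
have {}H (t t' : R) : `|t| <= `|s| -> `|t'| <= `|s| ->
  [/\ W (x + t%:C *: h + t'%:C *: k),
   `|rderive k (rderive h f) x - rderive k (rderive h f) (x + t%:C *:
     h + t'%:C *: k)| <= e / 2 &
   `|rderive h (rderive k f) x - rderive h (rderive k f) (x + t%:C *: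
     h + t'%:C *: k)| <= e / 2].
  rewrite (gtr0_norm s0) => ts ts'; apply: H.
    by apply: (le_lt_trans ts); apply: (lt_le_trans sm);
      rewrite ge_min lexx orbT.
  by apply: (le_lt_trans ts'); apply: (lt_le_trans sm); rewrite ge_min lexx.
have [|t [t' [ts ts' E1]]] := @second_difference f x h k s.
  move=> t t' ts ts'; have [Wt _ _] := H t t' ts ts'.
  by split; [exact: Ck_derivable Cf Wt|exact:
    Ck_derivable (Ck_rderive _ Cf) Wt].
have [|u [u' [us us' E2]]] := @second_difference f x k h s.
  move=> t1 t2 ts1 ts2; rewrite [x + _ + _]addrAC; have [Wt _ _] :=
    H t2 t1 ts2 ts1.
  by split; [exact: Ck_derivable Cf Wt|exact:
    Ck_derivable (Ck_rderive _ Cf) Wt].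
have [_ B1 _] := H t t' ts ts'.
have [_ _] := H u' u us' us; rewrite [x + _ + _]addrAC => B2.
(* Both sides, multiplied by the square of [s], are the same second difference. *)
have E : rderive k (rderive h f) (x + t%:C *: h + t'%:C *: k) =
         rderive h (rderive k f) (x + u%:C *: k + u'%:C *: h).
  have s_neq0 : s != 0 by rewrite gt_eqF.
  move: E1 E2; rewrite [x + s%:C *: k + s%:C *: h]addrAC.
  set A := rderive k (rderive h f) _; set B := rderive h (rderive k f) _.
  move: A B (f _) (f _) (f _) (f _) => A B a b c d' E1 E2.
  have : A * s * s = B * s * s by rewrite -E1 -E2; ring.
  by move=> /(mulIf s_neq0)/(mulIf s_neq0).
have tri (a b c : R) : `|a - c| <= e / 2 -> `|b - c| <= e / 2 -> `|a - b| <= e.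
  move=> ac bc; have -> : a - b = (a - c) - (b - c) by ring.
  by rewrite (splitr e); apply: (le_trans (ler_normB _ _)); apply: lerD.
apply: (tri _ _ _ B1).
exact: (eq_ind_r (fun z => `|rderive h (rderive k f) x - z| <= e / 2) B2 E).
Qed.

End Frames.

(** * Complex coordinates and the chain rule *)

(** A common interface for the two spaces that occur, the line [R[i]^o] containing the disc and the
    row space of a chart. The real coordinate directions are the vectors [fvec k] and
    ['i *: fvec k]. *)
Record frame (R : realType) (V : normedModType R[i]) (N : nat) := Frame {
  fvec : 'I_N -> V;
  fcoord : 'I_N -> {linear V -> R[i]^o};
  fcoord_continuous : forall k, continuous (fcoord k);
  frameE : forall v, v = \sum_k fcoord k v *: fvec k }.

Section RealParts.
Context {R : realType}.

Lemma normc_ge_Im (z : R[i]) : `|complex.Im z|%:C <= `|z|.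
Proof.
have := normc_ge_Re (z * 'i%C); rewrite ReiNIm normrN normrM.
suff -> : `|'i%C : R[i]| = 1 by rewrite mulr1.
by rewrite normc_def /= expr0n expr1n add0r sqrtr1.
Qed.

Lemma ReB (a b : R[i]) : complex.Re (a - b) = complex.Re a - complex.Re b.
Proof. by case: a b => [? ?] []. Qed.

Lemma ImB (a b : R[i]) : complex.Im (a - b) = complex.Im a - complex.Im b.
Proof. by case: a b => [? ?] []. Qed.

Lemma Re_continuous : continuous (fun z : R[i]^o => complex.Re z).
Proof.
have F (z : R[i]^o) : Filter (nbhs z) by exact: nbhs_filter.
move=> z; apply/(@cvgrPdist_le _ _ _ _ (F z)) => e e0.
have e0' : 0 < (e%:C : R[i]) by rewrite ltcR.
apply/nbhs_ballP; exists (e%:C : R[i]) => //= y.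
rewrite /ball /= -ReB -lecR => /ltW.
by apply: le_trans; exact: normc_ge_Re.
Qed.

Lemma Im_continuous : continuous (fun z : R[i]^o => complex.Im z).
Proof.
have F (z : R[i]^o) : Filter (nbhs z) by exact: nbhs_filter.
move=> z; apply/(@cvgrPdist_le _ _ _ _ (F z)) => e e0.
have e0' : 0 < (e%:C : R[i]) by rewrite ltcR.
apply/nbhs_ballP; exists (e%:C : R[i]) => //= y.
rewrite /ball /= -ImB -lecR => /ltW.
by apply: le_trans; exact: normc_ge_Im.
Qed.

Lemma ReZ (t : R) (z : R[i]) : complex.Re (t%:C * z) = t * complex.Re z.
Proof. by case: z => a b /=; rewrite mul0r subr0. Qed.

Lemma ImZ (t : R) (z : R[i]) : complex.Im (t%:C * z) = t * complex.Im z.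
Proof. by case: z => a b /=; rewrite mul0r addr0. Qed.

End RealParts.

Section ChainRule.
Context {R : realType} {V : normedModType R[i]}.
Implicit Types (x y h : V) (W : set V) (f : V -> R).

(* Caratheodory's form of differentiability: the quotients Qr and Qi are
  those of
   f along the staircase from x to y that changes one real coordinate at a
   time. *)
Lemma caratheodory N (E : frame V N) W f x : open W -> Ck 1 W f -> W x ->
  exists Qr Qi : 'I_N -> V -> R,
  [/\ forall k, Qr k y @[y --> x] --> rderive (fvec E k) f x,
      forall k, Qi k y @[y --> x] --> rderive ('i *: fvec E k) f x &
      forall y, f y - f x =
        \sum_k (complex.Re (fcoord E k (y - x)) * Qr k y
                + complex.Im (fcoord E k (y - x)) * Qi k y)].
Proof.
move=> oW Cf Wx.
(* The corner of the staircase at which the first [m] complex coordinates already agree with those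
   of [y]. *)
pose p (m : nat) y := x + \sum_(k < N | (k < m)%N) fcoord E k (y - x) *:
  fvec E k.
have coordx k : fcoord E k (y - x) @[y --> x] --> (0 : R[i]^o).
  rewrite -[X in _ --> X](linear0 (fcoord E k)) -[X in fcoord E k X](subrr x).
  apply: (@cvg_comp _ _ _ (fun y => y - x) (fcoord E k)); last exact:
    fcoord_continuous.
  by apply: cvgB; [exact: cvg_id|exact: cvg_cst].
have px m : p m y @[y --> x] --> x.
  rewrite -[X in _ --> X]addr0; apply: cvgD; first exact: cvg_cst.
  rewrite [X in _ --> X](_ : _ = \sum_(k < N | (k < m)%N) (0 : R[i]) *:
    fvec E k); last first.
    by rewrite big1 // => k _; rewrite scale0r.
  by apply: cvg_sumr => k _; apply: (@cvgZr_tmp R[i] V); exact: coordx.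
have Rex k : complex.Re (fcoord E k (y - x)) @[y --> x] --> (0 : R).
  exact: (cvg_comp _ _ (coordx k) (@Re_continuous R 0)).
have Imx k : complex.Im (fcoord E k (y - x)) @[y --> x] --> (0 : R).
  exact: (cvg_comp _ _ (coordx k) (@Im_continuous R 0)).
have ndf h : \forall z \near x, derivable (fun t : R => f (z + t%:C *: h)) 0 1.
  have nW : \forall y \near x, W y by exact: open_nbhs_nbhs (conj oW Wx).
  by apply: filterS nW => z; exact: Ck_derivable Cf.
have cdf h : {for x, continuous (rderive h f)}.
  exact: (Ck_continuous (Ck_rderive h Cf)).
(* The corner between [p k] and [p k.+1], where only the real part of coordinate [k] has been
   changed. *)
pose q (k : 'I_N) y := p k y + (complex.Re (fcoord E k (y - x)))%:C *: fvec E k.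
exists (fun (k : 'I_N) y => partial_quotient (fvec E k) f x (p k y)
  (complex.Re (fcoord E k (y - x)))).
exists (fun (k : 'I_N) y => partial_quotient ('i *: fvec E k) f x (q k y)
  (complex.Im (fcoord E k (y - x)))).
split=> [k|k|y].
- exact: cvg_partial_quotient.
- apply: cvg_partial_quotient => //.
  rewrite -[X in _ --> X]addr0 -[X in _ + X](scale0r (fvec E k)); apply:
    cvgD => //.
  apply: (@cvgZr_tmp R[i] V).
  exact: (cvg_comp _ _ (Rex k) (@real_complex_continuous R 0)).
(* The staircase runs from [x] to [y], so the increment telescopes over its corners. *)
- have p0 : p 0%N y = x by rewrite /p big_pred0 ?addr0.
  have pN : p N y = y.
    rewrite /p (eq_bigl xpredT) => [|k]; last exact: ltn_ord.
    by rewrite -frameE addrC subrK.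
  rewrite -[in LHS]pN -[X in _ - f X]p0 -(@telescope_sumr _ 0%N N (fun m =>
    f (p m y))) //.
  rewrite big_mkord; apply: eq_bigr => k _.
  rewrite -!partial_quotientE.
  have -> : p k.+1 y = q k y + (complex.Im (fcoord E k (y - x)))%:C *:
    ('i *: fvec E k).
    rewrite /q /p (bigD1 k) //= -!addrA; congr (_ + _); rewrite addrC.
    rewrite scalerA -scalerDl mulrC -complexiE -complexE; congr (_ + _).
    by apply: eq_bigl => j; rewrite ltnS [RHS]ltn_neqAle andbC.
  by rewrite /q; ring.
Qed.

End ChainRule.

(** The derivative at 0 of a curve with a real parameter. As [V] is a normed module over [R[i]], the
    difference quotient is written with the real scalar embedded in [R[i]]. *)
Definition has_velocity (R : realType) (V : normedModType R[i]) (c : R -> V)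
  (v : V) : Prop :=
  t^-1%:C *: (c t - c 0) @[t --> (0 : R)^'] --> v.

Section Velocity.
Context {R : realType}.

Lemma is_derive_quotient (g : R -> R) (l : R) :
  t^-1 * (g t - g 0) @[t --> (0 : R)^'] --> l -> is_derive (0 : R) 1 g l.
Proof.
have E : (fun t : R => t^-1 *: (g (t *: 1 + 0) - g 0)) = (fun t : R =>
  t^-1 * (g t - g 0)).
  by apply/funext => t; rewrite addr0 [t *: 1]mulr1.
move=> gl; split; first by rewrite /derivable /= E; apply/cvg_ex; exists l.
by rewrite /derive /= E; apply/cvg_lim.
Qed.

Lemma real_complex_dnbhs0 : (fun t : R => t%:C : R[i]) @ (0 : R)^' -->
  (0 : R[i]^o)^'.
Proof.
move=> P /= P0; have : \forall z \near (0 : R[i]^o), z != 0 -> P z by exact: P0.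
move=> /(@real_complex_continuous R 0) {}P0.
have {}P0 : \forall t \near (0 : R), t%:C != 0 -> P t%:C by exact: P0.
suff : \forall t \near (0 : R), t != 0 -> P t%:C by [].
near=> t => t0.
have : t%:C != 0 -> P t%:C by near: t.
by apply; apply: contra_neq t0 => -[].
Unshelve. all: by end_near.
Qed.

(** The complex difference quotient converges, hence also its restriction to real increments. *)
Lemma differentiable_velocity (V V' : normedModType R[i]) (c : V -> V') x h :
  differentiable c x -> has_velocity (fun t : R => c (x + t%:C *: h))
    ('d c x h).
Proof.
move=> dc; rewrite /has_velocity -deriveE //.
have : (fun t : R[i] => t^-1 *: ((c \o shift x) (t *: h) - c x))
  @ (0 : R[i]^o)^' --> 'D_h c x.
  exact: diff_derivable.
move=> /(cvg_comp _ _ real_complex_dnbhs0); apply: cvg_trans; apply: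
  near_eq_cvg.
near=> t => /=.
by rewrite fmorphV scale0r addr0 [_ *: h + x]addrC.
Unshelve. all: by end_near. Qed.

Lemma line_velocity (V : normedModType R[i]) (x h : V) :
  has_velocity (fun t : R => x + t%:C *: h) h.
Proof.
have : (fun _ : R => h) t @[t --> (0 : R)^'] --> h by exact: cvg_cst.
apply: cvg_trans; apply: near_eq_cvg; near=> t.
rewrite scale0r addr0 addrC addKr scalerA -rmorphM mulVf ?scale1r //.
by near: t; exact: nbhs_dnbhs_neq.
Unshelve. all: by end_near.
Qed.

Lemma velocity_cvg (V : normedModType R[i]) (c : R -> V) v : has_velocity c v ->
  c t @[t --> (0 : R)^'] --> c 0.
Proof.
move=> cv.
have : t%:C *: (t^-1%:C *: (c t - c 0)) + c 0 @[t --> (0 : R)^'] -->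
  (0 : R[i]) *: v + c 0.
  apply: cvgD; last exact: cvg_cst.
  apply: (@cvgZ R[i] V) cv.
  by move=> P /(@real_complex_continuous R 0); exact: nbhs_dnbhs.
rewrite scale0r add0r; apply: cvg_trans; apply: near_eq_cvg.
near=> t; rewrite scalerA -rmorphM divff ?scale1r ?subrK //.
by near: t; exact: nbhs_dnbhs_neq.
Unshelve. all: by end_near. Qed.

Lemma is_derive_Re (V : normedModType R[i]) (L : {linear V -> R[i]^o})
  (c : R -> V) v :
  continuous L -> has_velocity c v ->
  is_derive (0 : R) 1 (fun t => complex.Re (L (c t))) (complex.Re (L v)).
Proof.
move=> cL cv; apply: is_derive_quotient.
have -> : (fun t => t^-1 * (complex.Re (L (c t)) - complex.Re (L (c 0)))) =
    (fun t => complex.Re (L (t^-1%:C *: (c t - c 0)))).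
  by apply/funext => t; rewrite linearZ linearB ReZ ReB.
exact: (cvg_comp _ _ (cvg_comp _ _ cv (cL v)) (@Re_continuous R (L v))).
Qed.

Lemma is_derive_Im (V : normedModType R[i]) (L : {linear V -> R[i]^o})
  (c : R -> V) v :
  continuous L -> has_velocity c v ->
  is_derive (0 : R) 1 (fun t => complex.Im (L (c t))) (complex.Im (L v)).
Proof.
move=> cL cv; apply: is_derive_quotient.
have -> : (fun t => t^-1 * (complex.Im (L (c t)) - complex.Im (L (c 0)))) =
    (fun t => complex.Im (L (t^-1%:C *: (c t - c 0)))).
  by apply/funext => t; rewrite linearZ linearB ImZ ImB.
exact: (cvg_comp _ _ (cvg_comp _ _ cv (cL v)) (@Im_continuous R (L v))).
Qed.

End Velocity.

Section Chain.
Context {R : realType} {V : normedModType R[i]} {N : nat} (E : frame V N).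
Implicit Types (x y h : V) (W : set V) (f : V -> R).

(** In Caratheodory's factorization at [c t], dividing by [t] affects only the coordinates of the
    increment; these tend to the coordinates of [v], and the quotients tend to partial
    derivatives. *)
Lemma chain_frame W f (c : R -> V) v : open W -> Ck 1 W f -> W (c 0) ->
  has_velocity c v ->
  is_derive (0 : R) 1 (f \o c)
    (\sum_k (complex.Re (fcoord E k v) * rderive (fvec E k) f (c 0)
           + complex.Im (fcoord E k v) * rderive ('i *: fvec E k) f (c 0))).
Proof.
move=> oW Cf Wc cv; apply: is_derive_quotient.
have [Qr [Qi [Qr0 Qi0 fE]]] := caratheodory E oW Cf Wc.
have cc := velocity_cvg cv.
have coord k : fcoord E k (t^-1%:C *: (c t - c 0)) @[t --> (0 : R)^'] -->
  fcoord E k v.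
  exact: (cvg_comp _ _ cv (@fcoord_continuous _ _ _ E k v)).
have -> : (fun t => t^-1 * ((f \o c) t - (f \o c) 0)) = (fun t =>
   \sum_k (complex.Re (fcoord E k (t^-1%:C *: (c t - c 0))) * Qr k (c t)
         + complex.Im (fcoord E k (t^-1%:C *: (c t - c 0))) * Qi k (c t))).
  apply/funext => t /=; rewrite fE mulr_sumr; apply: eq_bigr => k _.
  by rewrite linearZ ReZ ImZ mulrDr !mulrA.
apply: cvg_sumr => k _; apply: cvgD; apply: cvgM.
- exact: (cvg_comp _ _ (coord k) (@Re_continuous R _)).
- exact: (cvg_comp _ _ cc (Qr0 k)).
- exact: (cvg_comp _ _ (coord k) (@Im_continuous R _)).
- exact: (cvg_comp _ _ cc (Qi0 k)).
Qed.

(** Applying [chain_frame] to a straight line shows that [rderive] is real linear in its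
    direction. *)
Lemma rderive_frame W f x h : open W -> Ck 1 W f -> W x ->
  rderive h f x = \sum_k (complex.Re (fcoord E k h) * rderive (fvec E k) f x
           + complex.Im (fcoord E k h) * rderive ('i *: fvec E k) f x).
Proof.
move=> oW Cf Wx; apply: rderive_val.
have c0 : x + (0 : R)%:C *: h = x by rewrite rmorph0 scale0r addr0.
have := @chain_frame W f (fun t : R => x + t%:C *: h) h oW Cf; rewrite c0.
by have lv := @line_velocity R V x h; move=> H; exact: H Wx lv.
Qed.

Lemma chain_rule W f (c : R -> V) v : open W -> Ck 1 W f -> W (c 0) ->
  has_velocity c v -> is_derive (0 : R) 1 (f \o c) (rderive v f (c 0)).
Proof.
by move=> oW Cf Wc cv; rewrite (rderive_frame v oW Cf Wc); exact:
  (chain_frame oW Cf Wc cv).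
Qed.

End Chain.

Section Differentiability.
Context {K : numFieldType} {V W : normedModType K}.

Lemma differentiable_bound (f : V -> W) (x : V) (L : {linear V -> W}) :
  continuous L ->
  (forall e, 0 < e -> \forall h \near (0 : V), `|f (h + x) - f x - L h| <=
    e * `|h|) ->
  differentiable f x /\ 'd f x = L :> (V -> W).
Proof.
move=> cL fL.
have E : f \o shift x = cst (f x) + L +o_ 0 id.
  apply/eqaddoP => e e0; near=> h => /=.
  rewrite [X in `|X|](_ : _ = f (h + x) - f x - L h); first by near: h;
    exact: fL.
  by rewrite /= /GRing.add /= opprD addrA.
have dE := diff_unique cL E.
by split=> //; apply/diff_locallyP; rewrite dE.
Unshelve. all: by end_near. Qed.

Lemma near_eq_differentiable (f g : V -> W) (x : V) :
  (\forall y \near x, f y = g y) -> differentiable f x ->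
  differentiable g x /\ 'd g x = 'd f x :> (V -> W).
Proof.
move=> fg df; apply: differentiable_bound; first exact: diff_continuous.
have fg0 : f x = g x := nbhs_singleton fg.
have {}fg : \forall h \near (0 : V), f (h + x) = g (h + x).
  by move: fg; rewrite (near_shift 0) subr0.
have [_ /eqaddoP fE] := (diff_locallyP _ _).1 df.
move=> e e0; near=> h; rewrite -fg0.
have <- : f (h + x) = g (h + x) by near: h.
have : `|(f \o shift x - (cst (f x) + 'd f x)) h| <= e * `|h| by near: h;
  exact: fE.
by rewrite /= {1}/GRing.add /= opprD addrA.
Unshelve. all: by end_near. Qed.

Lemma differentiable_row N (f : V -> 'rV[K]_N) (x : V) :
  (forall j, differentiable (fun y => f y 0 j : K^o) x) -> differentiable f x.
Proof.
move=> df.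
have -> : f = \sum_(j < N) (fun y => f y 0 j *: (delta_mx 0 j : 'rV[K]_N)).
  apply/funext => y; rewrite fct_sumE; apply/rowP => k.
  by rewrite [LHS](congr1 (fun u : 'rV__ => u 0 k) (row_sum_delta (f y))).
by apply: differentiable_sum => j; exact: differentiableZl.
Qed.

End Differentiability.

(** * Derivatives of holomorphic maps *)

Section CauchyRiemann.
Context {R : realType} {V : normedModType R[i]} {N : nat} (E : frame V N).
Implicit Types (x y h : V) (W : set V).

Lemma cvg_complex (T : Type) (F : set_system T) (FF : Filter F) (a b : T -> R)
  (l m : R) :
  a t @[t --> F] --> l -> b t @[t --> F] --> m ->
  (a t +i* b t : R[i]^o) @[t --> F] --> (l +i* m : R[i]^o).
Proof.
move=> al bm; rewrite [l +i* m]complexE.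
under eq_fun do rewrite [_ +i* _]complexE /=.
apply: (@cvgD R[i] R[i]^o).
  exact: (cvg_comp _ _ al (@real_complex_continuous R l)).
apply: (@cvgZl_tmp R[i] R[i]^o).
exact: (cvg_comp _ _ bm (@real_complex_continuous R m)).
Qed.

(** The equations make the real differential of P + iQ commute with multiplication by i, so the
    partial derivatives along [fvec k] alone determine a complex linear candidate [L].
    Caratheodory's factorization bounds the remainder. *)
Lemma cauchy_riemann W (P Q : V -> R) x : open W -> Ck 1 W P ->
  Ck 1 W Q -> W x ->
  (forall h, rderive ('i *: h) P x = - rderive h Q x) ->
  (forall h, rderive ('i *: h) Q x = rderive h P x) ->
  differentiable (fun y => P y +i* Q y : R[i]^o) x.
Proof.
move=> oW CP CQ Wx CR1 CR2.
have [Pr [Pi [Pr0 Pi0 PE]]] := caratheodory E oW CP Wx.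
have [Qr [Qi [Qr0 Qi0 QE]]] := caratheodory E oW CQ Wx.
pose D k : R[i] := rderive (fvec E k) P x +i* rderive (fvec E k) Q x.
pose L0 (h : V) : R[i]^o := \sum_k fcoord E k h * D k.
have L0lin : linear L0.
  move=> a u v; rewrite /L0 scaler_sumr -big_split /=; apply: eq_bigr => k _.
  by rewrite linearP mulrDl -mulrA.
pose L : {linear V -> R[i]^o} := HB.pack L0 (GRing.isLinear.Build _ _ _ _
  _ L0lin).
have cL : continuous L.
  move=> y; apply: (@cvg_sumr R[i] R[i]^o) => k _.
  by apply: (@cvgZr_tmp R[i] R[i]^o); exact: fcoord_continuous.
suff [//] : differentiable (fun y => P y +i* Q y : R[i]^o) x /\
  'd (fun y => P y +i* Q y : R[i]^o) x = L :> (V -> R[i]^o).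
apply: differentiable_bound => // e e0.
pose A k y : R[i]^o := (Pr k y +i* Qr k y) - D k.
pose B k y : R[i]^o := (Pi k y +i* Qi k y) - 'i * D k.
have A0 k : A k y @[y --> x] --> (0 : R[i]^o).
  rewrite -[X in _ --> X](subrr (D k)); apply: (@cvgB R[i] R[i]^o); last exact:
    cvg_cst.
  exact: cvg_complex.
have B0 k : B k y @[y --> x] --> (0 : R[i]^o).
  rewrite -[X in _ --> X](subrr ('i * D k)); apply: (@cvgB R[i] R[i]^o);
    last exact: cvg_cst.
  have -> : 'i * D k = rderive ('i *: fvec E k) P x +i* rderive ('i *:
    fvec E k) Q x.
    by rewrite CR1 CR2 /D -complexiE; apply/eqP; rewrite eq_complex /=
      !mul0r !mul1r sub0r add0r !eqxx.
  exact: cvg_complex.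
(* The remainder is a combination of the real coordinates of y - x whose coefficients [A k] and
   [B k] tend to 0. *)
have fE y : (P y +i* Q y) - (P x +i* Q x) - L (y - x) =
   \sum_k ((complex.Re (fcoord E k (y - x)))%:C * A k y +
     (complex.Im (fcoord E k (y - x)))%:C * B k y).
  rewrite [L _]/(L0 _) /L0.
  have -> : (P y +i* Q y) - (P x +i* Q x) = (P y - P x)%:C + 'i *
    (Q y - Q x)%:C.
    by rewrite -complexiE; apply/eqP; rewrite eq_complex /=; apply/andP; split;
      apply/eqP; ring.
  rewrite PE QE !rmorph_sum /= mulr_sumr -big_split -sumrB /=; apply:
    eq_bigr => k _.
  rewrite /A /B [in fcoord E k (y - x) * _](complexE (fcoord E k (y - x)))
    complexiE.
  rewrite [Pr k y +i* _]complexE [Pi k y +i* _]complexE /= complexiE.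
  rewrite !rmorphD !rmorphM /=.
  by ring.
(* Continuous coordinates are Lipschitz, which turns coefficients tending to 0 into a remainder that
   is o(h). *)
have Lip k : exists2 C : R[i], 0 < C & forall h, `|fcoord E k h| <= C * `|h|.
  exact: (linear_lipschitz (@fcoord_continuous _ _ _ E k)).
have [C C0 CP'] : exists2 C : 'I_N -> R[i], (forall k, 0 < C k) & forall k h,
  `|fcoord E k h| <= C k * `|h|.
  exists (fun k => s2val (cid2 (Lip k))) => k; first exact:
    (s2valP (cid2 (Lip k))).
  exact: (s2valP' (cid2 (Lip k))).
have S0 : \sum_k (C k * `|A k y| + C k * `|B k y|) @[y --> x] --> (0 : R[i]^o).
  rewrite [X in _ --> X](_ : _ = \sum_(k < N) (0 : R[i]^o));
    last by rewrite big1.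
  apply: (@cvg_sumr R[i] R[i]^o) => k _.
  rewrite -[X in _ --> X](addr0 (0 : R[i]^o)).
  apply: (@cvgD R[i] R[i]^o).
    rewrite -[X in _ --> X](mulr0 (C k)); apply: (@cvgZl_tmp R[i] R[i]^o).
    by rewrite -[X in _ --> X](@normr0 R[i] R[i]^o); apply:
      (@cvg_norm R[i] R[i]^o).
  rewrite -[X in _ --> X](mulr0 (C k)); apply: (@cvgZl_tmp R[i] R[i]^o).
  by rewrite -[X in _ --> X](@normr0 R[i] R[i]^o); apply:
    (@cvg_norm R[i] R[i]^o).
have : \forall y \near x, `|\sum_k (C k * `|A k y| + C k * `|B k y|)| <= e.
  exact: (@cvgr0_norm_le R[i] R[i]^o _ _ _ _ S0 _ e0).
rewrite (near_shift 0) subr0 => near_e; near=> h.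
have := fE (h + x); rewrite addrK => {}fE.
rewrite [X in `|X|]fE.
apply: (@le_trans _ _ (\sum_k (C k * `|A k (h + x)| + C k * `|B k (h + x)|)
  * `|h|)).
  apply: (le_trans (ler_norm_sum _ _ _)); apply: ler_sum => k _.
  rewrite mulrDl; apply: (le_trans (ler_normD _ _)); apply: lerD;
    rewrite normrM mulrAC.
    by apply: ler_pM => //; apply: le_trans (CP' k h);
      rewrite [`|_%:C|]normc_def /= expr0n addr0 sqrtr_sqr; exact: normc_ge_Re.
  by apply: ler_pM => //; apply: le_trans (CP' k h); rewrite [`|_%:C|]normc_def
    /= expr0n addr0 sqrtr_sqr; exact: normc_ge_Im.
rewrite -mulr_suml ler_wpM2r //.
have := near near_e h; rewrite /= ger0_norm; first by apply.
by apply: sumr_ge0 => k _; rewrite addr_ge0 // mulr_ge0 // ltW.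
Unshelve. all: by end_near. Qed.

End CauchyRiemann.

Section CoordinateFrames.
Context {R : realType}.

Definition row_coord N (k : 'I_N) (v : 'rV[R[i]]_N) : R[i]^o := v 0 k.

Lemma row_coord_linear N (k : 'I_N) : linear (row_coord k).
Proof. by move=> a u v; rewrite /row_coord !mxE. Qed.

HB.instance Definition _ N (k : 'I_N) :=
  GRing.isLinear.Build _ _ _ _ (row_coord k) (row_coord_linear k).

Lemma row_coord_continuous N (k : 'I_N) : continuous (row_coord k : Cn R N ->
  R[i]^o).
Proof. by move=> v; exact: coord_continuous. Qed.

Definition row_frame N : frame 'rV[R[i]]_N N :=
  @Frame R 'rV[R[i]]_N N (fun k => 'e_k) (fun k => row_coord k)
    (@row_coord_continuous N) (@row_sum_delta _ N).

Lemma scalar_frameE (v : R[i]^o) : v = \sum_(k < 1) idfun v *: (1 : R[i]^o).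
Proof. by rewrite big_ord_recl big_ord0 addr0 [_ *: _]mulr1. Qed.

Lemma scalar_id_continuous : continuous (idfun : R[i]^o -> R[i]^o).
Proof. by move=> v; exact: cvg_id. Qed.

Definition scalar_frame : frame R[i]^o 1 :=
  @Frame R R[i]^o 1 (fun _ => 1) (fun _ => idfun) (fun _ =>
    scalar_id_continuous) scalar_frameE.

End CoordinateFrames.

Section HolomorphicDerivative.
Context {R : realType} {V : normedModType R[i]} {N : nat} (E : frame V N).
Implicit Types (x y h : V) (W : set V).

Lemma near_line x h (P : set V) : (\near x, P x) -> \forall t \near (0 : R),
  P (x + t%:C *: h).
Proof.
move=> Px; apply: (@line_continuous R V x h 0).
by rewrite rmorph0 scale0r addr0.
Qed.

Lemma near_eq_rderive (f g : V -> R) x h : (\forall y \near x, f y = g y) ->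
  rderive h f x = rderive h g x.
Proof.
by move=> /(near_line h) fg; rewrite /rderive !derive1E; exact: near_eq_derive.
Qed.

Lemma near_eq_derivable_line (f g : V -> R) x h : (\forall y \near x,
  f y = g y) ->
  derivable (fun t : R => f (x + t%:C *: h)) 0 1 ->
  derivable (fun t : R => g (x + t%:C *: h)) 0 1.
Proof. by move=> /(near_line h) fg; exact: near_eq_derivable. Qed.

Lemma diff_ReIm m (f : V -> 'rV[R[i]]_m) x h (j : 'I_m) : differentiable f x ->
  'd f x h 0 j = rderive h (fun y => complex.Re (f y 0 j)) x
              +i* rderive h (fun y => complex.Im (f y 0 j)) x.
Proof.
move=> df; have v := @differentiable_velocity R V _ f x h df.
have c := @row_coord_continuous R m j.
rewrite (@rderive_val R V (fun y => complex.Re (f y 0 j)) x h _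
  (is_derive_Re c v)).
rewrite (@rderive_val R V (fun y => complex.Im (f y 0 j)) x h _
  (is_derive_Im c v)).
by rewrite [LHS]complexE [RHS]complexE.
Qed.

(** Compare real and imaginary parts in 'd f x (i h) = i 'd f x h. *)
Lemma rderive_cauchy_riemann m (f : V -> 'rV[R[i]]_m) x h (j : 'I_m) :
  differentiable f x ->
  rderive ('i *: h) (fun y => complex.Re (f y 0 j)) x = - rderive h (fun y =>
    complex.Im (f y 0 j)) x
  /\ rderive ('i *: h) (fun y => complex.Im (f y 0 j)) x = rderive h (fun y =>
    complex.Re (f y 0 j)) x.
Proof.
move=> df; have := diff_ReIm ('i *: h) j df.
rewrite linearZ mxE (diff_ReIm h j df) -complexiE => /eqP.
by rewrite eq_complex /= !mul0r !mul1r sub0r add0r => /andP[/eqP <- /eqP <-].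
Qed.

(** As [U] is open, the Cauchy-Riemann equations of [f] hold near [x] and may be differentiated
    along [b]; exchanging derivatives gives the equations for [rderive b P] and [rderive b Q], the
    two parts of an entry of the new map. *)
Lemma holomorphic_differentiable_diff m U (f : V -> 'rV[R[i]]_m) x b : open U ->
  holomorphic U f -> U x -> differentiable (fun y => 'd f y b) x.
Proof.
move=> oU [df sf] Ux; apply: differentiable_row => j.
have [sP sQ] := sf j.
set P := fun y => complex.Re (f y 0 j) in sP; set Q := fun y =>
  complex.Im (f y 0 j) in sQ.
have nU : \forall y \near x, U y by exact: open_nbhs_nbhs (conj oU Ux).
have [] // : differentiable (fun y => 'd f y b 0 j : R[i]^o) x /\
  'd (fun y => 'd f y b 0 j : R[i]^o) x = 'd (fun y => rderive b P y +i* rderive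
    b Q y : R[i]^o) x :> (V -> R[i]^o).
apply: near_eq_differentiable.
  by apply: filterS nU => y Uy; rewrite -diff_ReIm //; exact: df.
have CN (g : V -> R) h : Ck 2 U g -> rderive b (fun y => - rderive h g y) x =
  - rderive h (rderive b g) x.
  move=> Cg; rewrite (rderiveC b h oU Ux Cg).
  apply: rderive_val; apply: is_deriveN; apply: is_derive_rderive.
  exact: Ck_derivable (Ck_rderive h Cg) Ux.
apply: (cauchy_riemann E oU (Ck_rderive b (sP 2%N)) (Ck_rderive b (sQ 2%N))
  Ux) => h.
  rewrite -(CN _ _ (sQ 2%N)) (rderiveC b ('i *: h) oU Ux (sP 2%N)).
  apply: near_eq_rderive; apply: filterS nU => y /df dfy.
  exact: (rderive_cauchy_riemann h j dfy).1.
rewrite (rderiveC b ('i *: h) oU Ux (sQ 2%N)) (rderiveC b h oU Ux (sP 2%N)).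
apply: near_eq_rderive; apply: filterS nU => y /df dfy.
exact: (rderive_cauchy_riemann h j dfy).2.
Qed.

End HolomorphicDerivative.

(** * Operations on C^k functions *)

Section CkAlgebra.
Context {R : realType} {V : normedModType R[i]}.
Implicit Types (x y h : V) (U : set V) (f g : V -> R).

(** Openness makes equality on [U] an equality of germs, so it passes to derivatives of every
    order. *)
Lemma eq_Ck n U f g : open U -> (forall x, U x -> f x = g x) -> Ck n U f ->
  Ck n U g.
Proof.
move=> oU; elim: n f g => [|n IH] f g fg Cf;
  have nfg x : U x -> \forall y \near x, f y = g y.
- by move=> Ux; have nU := open_nbhs_nbhs (conj oU Ux); exact: filterS nU.
- split=> // x Ux; rewrite /prop_for /continuous_at -(fg x Ux).
  exact: cvg_trans (near_eq_cvg (nfg x Ux)) (Ck_continuous Cf Ux).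
- by move=> Ux; have nU := open_nbhs_nbhs (conj oU Ux); exact: filterS nU.
split=> [x Ux|h].
  rewrite /prop_for /continuous_at -(fg x Ux).
  exact: cvg_trans (near_eq_cvg (nfg x Ux)) (Ck_continuous Cf Ux).
split=> [x Ux|].
  exact: near_eq_derivable_line (nfg x Ux) (Ck_derivable Cf Ux).
apply: IH (Ck_rderive h Cf) => x Ux.
exact: near_eq_rderive (nfg x Ux).
Qed.

Lemma Ck_cst n U (a : R) : Ck n U (fun _ => a).
Proof.
elim: n a => [|n IH] a; first by split=> // x _; exact: cvg_cst.
split=> [x _|h]; first exact: cvg_cst.
split=> [x _|]; first exact: derivable_cst.
have -> : rderive h (fun _ => a) = (fun _ => 0) by apply/funext => x; exact:
  derive1_cst.
exact: IH.
Qed.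

Lemma CkD n U f g : open U -> Ck n U f -> Ck n U g ->
  Ck n U (fun x => f x + g x).
Proof.
move=> oU; elim: n f g => [|n IH] f g Cf Cg.
  split=> // x Ux; apply: cvgD; [exact: (Ck_continuous Cf Ux)|exact:
    (Ck_continuous Cg Ux)].
split=> [x Ux|h].
  apply: cvgD; [exact: (Ck_continuous Cf Ux)|exact: (Ck_continuous Cg Ux)].
have dD x : U x -> is_derive (0 : R) 1 (fun t : R => f (x + t%:C *: h) + g
  (x + t%:C *: h))
    (rderive h f x + rderive h g x).
  move=> Ux; have df := is_derive_rderive (Ck_derivable (h := h) Cf Ux).
  have dg := is_derive_rderive (Ck_derivable (h := h) Cg Ux).
  exact: is_deriveD.
split=> [x /dD[]//|].
apply: (@eq_Ck n U (fun x => rderive h f x + rderive h g x)) => // [x Ux|].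
  by rewrite (rderive_val (f := fun x => f x + g x) (dD x Ux)).
by apply: IH; exact: Ck_rderive.
Qed.

Lemma CkM n U f g : open U -> Ck n U f -> Ck n U g ->
  Ck n U (fun x => f x * g x).
Proof.
move=> oU; elim: n f g => [|n IH] f g Cf Cg.
  split=> // x Ux; apply: cvgM; [exact: (Ck_continuous Cf Ux)|exact:
    (Ck_continuous Cg Ux)].
split=> [x Ux|h].
  apply: cvgM; [exact: (Ck_continuous Cf Ux)|exact: (Ck_continuous Cg Ux)].
have dM x : U x -> is_derive (0 : R) 1 (fun t : R => f (x + t%:C *: h) * g
  (x + t%:C *: h))
    (f x * rderive h g x + g x * rderive h f x).
  move=> Ux; have df := is_derive_rderive (Ck_derivable (h := h) Cf Ux).
  have dg := is_derive_rderive (Ck_derivable (h := h) Cg Ux).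
  by have := is_deriveM df dg; rewrite rmorph0 scale0r addr0.
split=> [x /dM[]//|].
apply: (@eq_Ck n U (fun x => f x * rderive h g x + g x * rderive h f x)) =>
  // [x Ux|].
  by rewrite (rderive_val (f := fun x => f x * g x) (dM x Ux)).
apply: CkD => //; apply: IH; first [exact: CkW|exact: Ck_rderive].
Qed.

Lemma CkV n U f : open U -> (forall x, U x -> f x != 0) -> Ck n U f ->
  Ck n U (fun x => (f x)^-1).
Proof.
move=> oU f0; elim: n f f0 => [|n IH] f f0 Cf.
  by split=> // x Ux; apply: cvgV; [exact: f0|exact: (Ck_continuous Cf Ux)].
split=> [x Ux|h].
  by apply: cvgV; [exact: f0|exact: (Ck_continuous Cf Ux)].
(* The derivative is written as a product of constants, inverses and [rderive h f], so that [CkM]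
   and the induction hypothesis apply to it. *)
have dV x : U x -> is_derive (0 : R) 1 (fun t : R => (f (x + t%:C *: h))^-1)
    (-1 * (((f x)^-1 * (f x)^-1) * rderive h f x)).
  move=> Ux; have df := is_derive_rderive (Ck_derivable (h := h) Cf Ux).
  have fx0 : f (x + (0 : R)%:C *: h) != 0 by rewrite rmorph0 scale0r addr0 f0.
  have df1 : derivable (fun t : R => f (x + t%:C *: h)) 0 1 by case: df.
  split; first exact: derivableV.
  rewrite deriveV // derive_val rmorph0 scale0r addr0 expr2 invfM mulN1r.
  by rewrite [_ *: _]mulNr.
split=> [x /dV[]//|].
apply: (@eq_Ck n U (fun x => -1 * (((f x)^-1 * (f x)^-1) * rderive h f x))) =>
  // [x Ux|].
  by rewrite (rderive_val (f := fun x => (f x)^-1) (dV x Ux)).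
apply: CkM => //; first exact: Ck_cst.
have CV : Ck n U (fun x => (f x)^-1) by apply: IH => //; exact: CkW.
by apply: CkM => //; [exact: CkM|exact: Ck_rderive].
Qed.

Lemma Ck_ln n U f : open U -> (forall x, U x -> 0 < f x) -> Ck n U f ->
  Ck n U (fun x => ln (f x)).
Proof.
move=> oU f0 Cf.
have cln x : U x -> {for x, continuous (fun x => ln (f x))}.
  move=> Ux; apply: continuous_comp; first exact: Ck_continuous Cf _ Ux.
  exact: continuous_ln (f0 _ Ux).
case: n Cf => [|n] Cf; first by split.
split=> // h.
have dl x : U x -> is_derive (0 : R) 1 (fun t : R => ln (f (x + t%:C *: h)))
    ((f x)^-1 * rderive h f x).
  move=> Ux; have df := is_derive_rderive (Ck_derivable (h := h) Cf Ux).
  have dln := is_derive1_ln (f0 _ Ux).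
  have x0 : f (x + (0 : R)%:C *: h) = f x by rewrite rmorph0 scale0r addr0.
  rewrite -x0 in dln *.
  by have := @is_derive1_comp R (@ln R) (fun t : R => f (x + t%:C *: h)) 0 _
    _ dln df.
split=> [x /dl[]//|].
apply: (@eq_Ck n U (fun x => (f x)^-1 * rderive h f x)) => // [x Ux|].
  by rewrite (rderive_val (f := fun x => ln (f x)) (dl x Ux)).
apply: CkM => //; last exact: Ck_rderive.
apply: CkV => //; last exact: CkW.
by move=> x /f0 /gt_eqF ->.
Qed.

End CkAlgebra.

(** * The Levi form along holomorphic maps *)

Section LeviForm.
Context {R : realType}.

Lemma cderive_real (V : normedModType R[i]) (h : V) (f : V -> R) x :
  cderive h (fun y => (f y)%:C) x = (rderive h f x)%:C.
Proof.
rewrite /cderive /=; congr (_ +i* _).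
exact: derive1_cst.
Qed.

(** The imaginary part is kept because for distinct [h] and [k] it contributes to the real part of
    the Hermitian sum. *)
Lemma wirt_wirtbar_real (V : normedModType R[i]) (h k : V) (f : V -> R) x :
  (forall a b, derivable (fun t : R => rderive b f (x + t%:C *: a)) 0 1) ->
  wirt h (wirtbar k (fun y => (f y)%:C)) x =
  4^-1 * ((rderive h (rderive k f) x + rderive ('i *: h)
    (rderive ('i *: k) f) x)
      +i* (rderive h (rderive ('i *: k) f) x - rderive ('i *: h)
        (rderive k f) x)).
Proof.
move=> df.
have wE : wirtbar k (fun y => (f y)%:C) =
    (fun y => (2^-1 * rderive k f y) +i* (2^-1 * rderive ('i *: k) f y)).
  apply/funext => y; rewrite /wirtbar !cderive_real.
  rewrite [RHS]complexE /= -complexiE !rmorphM fmorphV /= rmorph_nat.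
  by rewrite mulrDr mulrCA.
have half a b : rderive a (fun y => 2^-1 * rderive b f y) x = 2^-1 * rderive a
  (rderive b f) x.
  apply: rderive_val; apply: is_deriveZ.
  exact: is_derive_rderive.
rewrite wE /wirt /cderive /= !half.
move: (rderive h (rderive k f) x) (rderive ('i *: h) (rderive ('i *: k) f) x).
move: (rderive h (rderive ('i *: k) f) x) (rderive ('i *: h) (rderive k f) x) =>
  a b p q.
have -> : (4 : R[i])^-1 = 2^-1 * (2^-1)%:C.
  have -> : (2^-1 : R)%:C = 2^-1 by rewrite fmorphV /= rmorph_nat.
  have -> : (4 : R[i]) = 2 * 2 by rewrite mulr_natl -mulrnA.
  by rewrite invfM.
rewrite -mulrA; congr (_ * _); rewrite -complexiE.
by apply/eqP; rewrite eq_complex /=; apply/andP; split; apply/eqP; ring.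
Qed.

Lemma is_derive_bigsum n (h : 'I_n -> R -> R) (x : R) (dh : 'I_n -> R) :
  (forall i, is_derive x 1 (h i) (dh i)) ->
  is_derive x 1 (fun t => \sum_i h i t) (\sum_i dh i).
Proof.
move=> dhi; have := @is_derive_sum R R R n h x 1 dh dhi.
by rewrite fct_sumE.
Qed.

Lemma rderiveN_dir (V : normedModType R[i]) N (E : frame V N) W (u : V ->
  R) x h :
  open W -> Ck 1 W u -> W x -> rderive (- h) u x = - rderive h u x.
Proof.
move=> oW Cu Wx; rewrite !(rderive_frame E _ oW Cu Wx) -sumrN.
by apply: eq_bigr => k _; rewrite linearN !raddfN /= !mulNr opprD.
Qed.

Section Chain.
Context {V V' : normedModType R[i]} {N : nat} (E : frame V' N).
Context {W : set V'} {u : V' -> R} (oW : open W) (Cu : Ck 2 W u).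
Context {c : V -> V'} {x : V}.
Context (dc : \forall y \near x, differentiable c y).
Context (ddc : forall h, differentiable (fun y => 'd c y h) x).
Context (Wcx : W (c x)).

Let nW : \forall y \near x, W (c y).
Proof.
have cc : {for x, continuous c} by apply: differentiable_continuous; exact:
  nbhs_singleton dc.
by apply: cc; exact: open_nbhs_nbhs (conj oW Wcx).
Qed.

Lemma rderive_comp h : \forall y \near x, rderive h (u \o c) y =
  rderive ('d c y h) u (c y).
Proof.
near=> y; apply: rderive_val.
have cy0 : c (y + (0 : R)%:C *: h) = c y by rewrite scale0r addr0.
rewrite -[in X in is_derive _ _ _ X]cy0.
apply: (chain_rule E oW (CkW Cu)).
  by rewrite cy0; near: y.
by apply: differentiable_velocity; near: y.
Unshelve. all: by end_near. Qed.

(** The first summand carries the second derivative of [c]. The sum is the Hessian of [u] on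
    ['d c x h] and ['d c x k], the latter vector being expanded in the frame. *)
Lemma is_derive2_comp h k :
  is_derive (0 : R) 1 (fun t : R => rderive k (u \o c) (x + t%:C *: h))
  (rderive ('d (fun y => 'd c y k) x h) u (c x) +
   \sum_j (complex.Re (fcoord E j ('d c x k)) * rderive ('d c x h)
     (rderive (fvec E j) u) (c x)
         + complex.Im (fcoord E j ('d c x k)) * rderive ('d c x h)
           (rderive ('i *: fvec E j) u) (c x))).
Proof.
have cu := rderive_comp k.
pose z j y := fcoord E j ('d c y k).
(* The direction ['d c y k] moves with [y]. In the frame only the scalar coefficients move, and the
   product rule applies term by term. *)
pose F t := \sum_j (complex.Re (z j (x + t%:C *: h)) * rderive (fvec E j) u
  (c (x + t%:C *: h))
                  + complex.Im (z j (x + t%:C *: h)) * rderive ('i *: fvec E j)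
                    u (c (x + t%:C *: h))).
have nF : \forall t \near (0 : R), F t = rderive k (u \o c) (x + t%:C *: h).
  apply: (near_line h (P := fun y =>
    \sum_j (complex.Re (z j y) * rderive (fvec E j) u (c y)
    + complex.Im (z j y) * rderive ('i *: fvec E j) u (c y)) = rderive k (u
      \o c) y)).
  near=> y; have -> : rderive k (u \o c) y = rderive ('d c y k) u (c y) by
    near: y.
  by rewrite (rderive_frame E _ oW (CkW Cu)) //; near: y.
apply: (near_eq_is_derive nF).
have SE := rderive_frame E ('d (fun y => 'd c y k) x h) oW (CkW Cu) Wcx.
apply: (is_derive_eq _ (congr1 (+%R^~ _) (esym SE))).
rewrite -big_split.
apply: is_derive_bigsum => j.
have x0 : x + (0 : R)%:C *: h = x by rewrite scale0r addr0.
have vz := @differentiable_velocity R V V' (fun y => 'd c y k) x h (ddc k).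
have vc := @differentiable_velocity R V V' c x h (nbhs_singleton dc).
have Re' := is_derive_Re (@fcoord_continuous _ _ _ E j) vz.
have Im' := is_derive_Im (@fcoord_continuous _ _ _ E j) vz.
have chain e : is_derive (0 : R) 1 (fun t : R =>
  rderive e u (c (x + t%:C *: h))) (rderive ('d c x h) (rderive e u) (c x)).
  have := chain_rule E oW (Ck_rderive e Cu) _ vc.
  by rewrite x0; apply.
have := is_deriveD (is_deriveM Re' (chain (fvec E j)))
  (is_deriveM Im' (chain ('i *: fvec E j))).
rewrite x0 => H; apply: (is_derive_eq H).
move: (rderive ('d c x h) (rderive (fvec E j) u) (c x))
  (rderive ('d c x h) (rderive ('i *: fvec E j) u) (c x)) => D1 D2.
move: (rderive (fvec E j) u (c x)) (rderive ('i *: fvec E j) u (c x)) => D3 D4.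
move: (fcoord E j _) (fcoord E j _) => z1 z2; rewrite /GRing.scale /=.
move: (complex.Re z1) (complex.Re z2) (complex.Im z1) (complex.Im z2) =>
  a b d e.
by ring.
Unshelve. all: by end_near. Qed.

End Chain.
End LeviForm.

Lemma diff_scaled (K : numFieldType) (V W : normedModType K) (f g : V ->
  W) k x :
  differentiable f x -> (forall y, g y = k *: f y) ->
  forall h, 'd g x h = k *: 'd f x h.
Proof.
move=> df gf h; have -> : g = k *: f by apply/funext.
by rewrite diffZ.
Qed.

Section LeviChain.
Context {R : realType}.

Lemma Re_sum (I : Type) (r : seq I) (P : pred I) (F : I -> R[i]) :
  complex.Re (\sum_(i <- r | P i) F i) = \sum_(i <- r | P i) complex.Re (F i).
Proof. by apply: big_morph => // -[? ?] [? ?]. Qed.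

(* Here ie l and Y play the roles of i e_l and i X; keeping them abstract stops
   conversion from unfolding multiplication by i. *)
Lemma hermitian_expansion (T : Type) N (H : T -> T -> R) (e ie : 'I_N -> T)
    (co : T -> 'I_N -> R[i]) (X Y : T) :
  (forall Z k, H Z k = \sum_l (complex.Re (co Z l) * H (e l) k + complex.Im
    (co Z l) * H (ie l) k)) ->
  (forall j, co Y j = 'i%C * co X j) ->
  complex.Re (\sum_l \sum_j
    4^-1 * ((H (e l) (e j) + H (ie l) (ie j)) +i*
      (H (e l) (ie j) - H (ie l) (e j)))
         * co X l * (co X j)^*%R) =
  4^-1 * (\sum_j (complex.Re (co X j) * H X (e j) + complex.Im (co X j) * H
    X (ie j))
        + \sum_j (complex.Re (co Y j) * H Y (e j) + complex.Im (co Y j) * H Y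
          (ie j))).
Proof.
move=> HE YX.
rewrite exchange_big /= Re_sum -big_split /= mulr_sumr; apply: eq_bigr => j _.
rewrite (HE X (e j)) (HE X (ie j)) (HE Y (e j)) (HE Y (ie j)) Re_sum.
rewrite !mulr_sumr -!big_split /= mulr_sumr; apply: eq_bigr => l _.
rewrite !YX.
have -> : (4 : R[i])^-1 = (4^-1 : R)%:C by rewrite fmorphV /= rmorph_nat.
move: (H (e l) (e j)) (H (e l) (ie j)) (H (ie l) (e j)) (H (ie l) (ie j)) =>
  a b d f.
move: (co X l) (co X j) => [xl yl] [xj yj] /=.
by ring.
Qed.

(** The Levi form as a quarter of Hess u (X, X) + Hess u (iX, iX), with the second argument of each
    Hessian expanded as in [is_derive2_comp]. *)
Lemma levi_coordE N (W : set (Cn R N)) (u : Cn R N -> R) (x X Y : Cn R N) :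
  open W -> Ck 2 W u -> W x -> Y = 'i *: X ->
  levi_coord u x X = 4^-1 *
    (\sum_j (complex.Re (row_coord j X) * rderive X
      (rderive ('e_j : Cn R N) u) x
           + complex.Im (row_coord j X) * rderive X
             (rderive ('i *: 'e_j : Cn R N) u) x)
   + \sum_j (complex.Re (row_coord j Y) * rderive Y
     (rderive ('e_j : Cn R N) u) x
           + complex.Im (row_coord j Y) * rderive Y
             (rderive ('i *: 'e_j : Cn R N) u) x)).
Proof.
move=> oW Cu Wx YX.
have HE (Z k : Cn R N) := rderive_frame (row_frame N) Z oW (Ck_rderive k Cu) Wx.
have YX' j : row_coord j Y = 'i%C * row_coord j X.
  by rewrite YX /row_coord mxE -complexiE.
rewrite -(hermitian_expansion (H := fun a b => rderive a (rderive b u) x)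
  HE YX').
rewrite /levi_coord; congr complex.Re; apply: eq_bigr => a _; apply:
  eq_bigr => b _.
congr (_ * _ * _).
apply: (@wirt_wirtbar_real R (Cn R N)) => h k.
exact: Ck_derivable (Ck_rderive k Cu) Wx.
Qed.

Lemma levi_chain (V : normedModType R[i]) N (W : set (Cn R N)) (u : Cn R N -> R)
    (c : V -> Cn R N) (x h : V) :
  open W -> Ck 2 W u -> W (c x) ->
  (\forall y \near x, differentiable c y) ->
  (forall k, differentiable (fun y => 'd c y k) x) ->
  complex.Re (wirt h (wirtbar h (fun y => (u (c y))%:C)) x) = levi_coord u (c x)
    ('d c x h).
Proof.
move=> oW Cu Wcx dc ddc.
have D2 a b := is_derive2_comp (row_frame N) oW Cu dc ddc Wcx a b.
rewrite wirt_wirtbar_real; last by move=> a b; have [] := D2 a b.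
rewrite -[fun y => u (c y)]/(u \o c).
have dcx : differentiable c x := nbhs_singleton dc.
have dE : 'd c x ('i *: h) = 'i *: 'd c x h by rewrite linearZ.
rewrite (levi_coordE oW Cu Wcx dE).
have D11 := rderive_val (D2 h h).
have D22 := rderive_val (D2 ('i *: h) ('i *: h)).
(* Complex linearity in both directions gives the factor i squared; this sign cancels the
   second-order term of [c]. *)
have SE : 'd (fun y => 'd c y ('i *: h)) x ('i *: h) = - 'd (fun y =>
  'd c y h) x h.
  have sc y : 'd c y ('i *: h) = 'i *:
    'd c y h by rewrite (linearZZ ('d c y) 'i h).
  apply: (etrans (diff_scaled (ddc h) sc _)).
  rewrite (linearZZ ('d (fun y => 'd c y h) x) 'i h) scalerA -expr2 sqrCi.
  exact: scaleN1r.
have SN := rderiveN_dir (row_frame N) ('d (fun y => 'd c y h) x h) oW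
  (CkW Cu) Wcx.
have {}D22 := etrans D22
  (congr1 (+%R^~ _) (etrans (congr1 (fun z => rderive z u (c x)) SE) SN)).
move: D11 D22.
move: (rderive h (rderive h (u \o c)) x)
  (rderive ('i *: h) (rderive ('i *: h) (u \o c)) x) => A B.
move=> -> ->.
have -> : (4 : R[i])^-1 = (4^-1 : R)%:C by rewrite fmorphV /= rmorph_nat.
rewrite ReZ /=; congr (_ * _).
have cancel (a b d : R) : d + a + (- d + b) = a + b by ring.
exact: cancel.
Qed.

End LeviChain.

Section LeviProperties.
Context {R : realType}.

Lemma near_eq_cderive (V : normedModType R[i]) (h : V) (f g : V -> R[i]) x :
  (\forall y \near x, f y = g y) -> cderive h f x = cderive h g x.
Proof.
move=> fg; rewrite /cderive; congr (_ +i* _); apply: near_eq_rderive.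
  by apply: filterS fg => y ->.
by apply: filterS fg => y ->.
Qed.

Lemma near_eq_wirt (V : normedModType R[i]) (h : V) (f g : V -> R[i]) x :
  (\forall y \near x, f y = g y) -> wirt h f x = wirt h g x.
Proof. by move=> fg; rewrite /wirt !(near_eq_cderive _ fg). Qed.

Lemma near_eq_wirtbar (V : normedModType R[i]) (h : V) (f g : V -> R[i]) x :
  (\forall y \near x, f y = g y) -> wirtbar h f x = wirtbar h g x.
Proof. by move=> fg; rewrite /wirtbar !(near_eq_cderive _ fg). Qed.

Lemma near_eq_wirt_wirtbar (V : normedModType R[i]) (h k : V) (f g : V -> R) x :
  (\forall y \near x, f y = g y) ->
  wirt h (wirtbar k (fun y => (f y)%:C)) x =
    wirt h (wirtbar k (fun y => (g y)%:C)) x.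
Proof.
move=> /near_join fg; apply: near_eq_wirt; apply: filterS fg => y fg.
by apply: near_eq_wirtbar; apply: filterS fg => z ->.
Qed.

Lemma near_eq_levi_coord N (u v : Cn R N -> R) (x X : Cn R N) :
  (\forall y \near x, u y = v y) -> levi_coord u x X = levi_coord v x X.
Proof.
move=> uv; rewrite /levi_coord; apply: (congr1 (@complex.Re R)).
apply: eq_bigr => a _; apply: eq_bigr => b _.
apply: (congr1 (fun z => z * X 0 a * (X 0 b)^*%R)).
apply: (@near_eq_wirt_wirtbar (Cn R N)); exact: uv.
Qed.

Lemma levi_coordZ N (u : Cn R N -> R) (x X : Cn R N) (l : R[i]) (r : R) :
  r%:C = `|l| ^+ 2 -> levi_coord u x (l *: X) = r * levi_coord u x X.
Proof.
move=> rl; rewrite /levi_coord -ReZ; apply: (congr1 (@complex.Re R)).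
rewrite mulr_sumr; apply: eq_bigr => a _; rewrite mulr_sumr; apply:
  eq_bigr => b _.
rewrite rl normCK !mxE rmorphM /=.
by move: (wirt _ _ _) (X _ _) (X _ _)^*%R (l^*)%R => A B D d; ring.
Qed.

Lemma rderive2B (V : normedModType R[i]) (W : set V) (u v : V -> R) x h k :
  open W -> Ck 2 W u -> Ck 2 W v -> W x ->
  rderive h (rderive k (fun y => u y - v y)) x = rderive h (rderive k u) x -
    rderive h (rderive k v) x.
Proof.
move=> oW Cu Cv Wx.
transitivity (rderive h (fun y => rderive k u y - rderive k v y) x).
  apply: near_eq_rderive; have nW := open_nbhs_nbhs (conj oW Wx).
  apply: filterS nW => y Wy; apply: rderive_val; apply: is_deriveB.
    exact: is_derive_rderive (Ck_derivable Cu Wy).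
  exact: is_derive_rderive (Ck_derivable Cv Wy).
apply: rderive_val; apply: is_deriveB.
  exact: is_derive_rderive (Ck_derivable (Ck_rderive k Cu) Wx).
exact: is_derive_rderive (Ck_derivable (Ck_rderive k Cv) Wx).
Qed.

Lemma levi_coordB N (W : set (Cn R N)) (u v : Cn R N -> R) (x X : Cn R N) :
  open W -> Ck 2 W u -> Ck 2 W v -> W x ->
  levi_coord (fun y => u y - v y) x X = levi_coord u x X - levi_coord v x X.
Proof.
move=> oW Cu Cv Wx.
(* Smoothness of the difference is obtained from u + (-1) v. *)
have C1 := CkM oW (Ck_cst 2 W (-1)) Cv.
have uvE y : W y -> u y + -1 * v y = u y - v y by rewrite mulN1r.
have CB := eq_Ck oW uvE (CkD oW Cu C1).
have -> := levi_coordE oW CB Wx (erefl ('i *: X)).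
have -> := levi_coordE oW Cu Wx (erefl ('i *: X)).
have -> := levi_coordE oW Cv Wx (erefl ('i *: X)).
rewrite -mulrBr; congr (_ * _).
have sumlin (a b p q pu qu pv qv : 'I_N -> R) :
    (forall j, p j = pu j - pv j) -> (forall j, q j = qu j - qv j) ->
    \sum_j (a j * p j + b j * q j) =
    \sum_j (a j * pu j + b j * qu j) - \sum_j (a j * pv j + b j * qv j).
  by move=> pE qE; rewrite -sumrB; apply: eq_bigr => j _; rewrite pE qE; ring.
have addlin (A B Au Bu Av Bv : R) : A = Au - Av -> B = Bu - Bv ->
  A + B = (Au + Bu) - (Av + Bv) by move=> -> ->; ring.
by apply: addlin; apply: sumlin => j; exact: (rderive2B _ _ oW Cu Cv Wx).
Qed.

End LeviProperties.

(** * Coordinate changes of M and TM *)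

(* [vector.coord] hides it. *)
Local Notation coord := Defs.coord.

Lemma localizeE (R : realType) (n : nat) (T : Type) (A : atlas R n T)
  (Y : zmodType)
    (i : idx A) (f : T -> Y) p :
  dom i p -> (forall q, dom i q -> coord i q = coord i p -> f q = f p) ->
  localize i f (coord i p) = f p.
Proof.
move=> ip inj; rewrite /localize; case: xgetP =>
  [y _ [q [iq qp <-]]|/(_ (f p))[]].
  exact: inj.
by exists p.
Qed.

Section Transition.
Context {R : realType} {n : nat} {M : complex_manifold R n}.
Local Notation I := (idx (charts M)).
Implicit Types (i j k : I) (p q : M).

Definition transition i j : Cn R n -> Cn R n := localize i (coord j).

Definition overlap i j : set (Cn R n) := coord i @` (dom i `&` dom j).

Lemma coord_injP i p q : dom i p -> dom i q -> coord i p = coord i q -> p = q.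
Proof. by move=> ip iq; apply: (@coord_inj _ _ M i); rewrite inE. Qed.

Lemma transitionE i j p : dom i p -> transition i j (coord i p) = coord j p.
Proof. by move=> ip; apply: localizeE => // q iq /(coord_injP iq ip) ->. Qed.

Lemma overlap_open i j : open (overlap i j).
Proof.
by apply: coord_open; [apply: openI; exact: dom_open|move=> p []].
Qed.

Lemma overlap_coord i j p : dom i p -> dom j p -> overlap i j (coord i p).
Proof. by move=> ip jp; exists p. Qed.

Lemma transition_holomorphic i j : holomorphic (overlap i j) (transition i j).
Proof. exact: coord_change. Qed.

Lemma transition_differentiable i j p : dom i p -> dom j p ->
  differentiable (transition i j) (coord i p : Cn R n).
Proof.
move=> ip jp; have [df _] := transition_holomorphic i j.
by apply: df; exact: overlap_coord.
Qed.

Lemma near_overlap i j p : dom i p -> dom j p ->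
  nbhs (coord i p : Cn R n) (overlap i j).
Proof.
move=> ip jp.
exact: open_nbhs_nbhs (conj (@overlap_open i j) (overlap_coord ip jp)).
Qed.

Lemma diff_transition_comp i j k p h : dom i p -> dom j p -> dom k p ->
  'd (transition i k) (coord i p : Cn R n) h =
  'd (transition j k) (coord j p : Cn R n) ('d (transition i j)
    (coord i p : Cn R n) h).
Proof.
move=> ip jp kp.
have dij := transition_differentiable ip jp.
have djk := transition_differentiable jp kp.
rewrite -(transitionE j ip) in djk *.
have nE : \forall x \near (coord i p : Cn R n),
    (transition j k \o transition i j) x = transition i k x.
  apply: filterS (near_overlap ip jp) => _ [q [iq jq] <-].
  by rewrite /= !transitionE.
have [_ dE] := near_eq_differentiable nE (differentiable_comp dij djk).
apply: (etrans (congr1 (fun f : Cn R n -> Cn R n => f h) dE)).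
exact: (congr1 (fun f : Cn R n -> Cn R n => f h) (diff_comp dij djk)).
Qed.

Lemma diff_transition_id i p h : dom i p -> 'd (transition i i)
  (coord i p : Cn R n) h = h.
Proof.
move=> ip.
have nE : \forall x \near (coord i p : Cn R n), x = transition i i x.
  apply: filterS (near_overlap ip ip) => _ [q [iq _] <-].
  by rewrite transitionE.
have [did dE0] := is_diff_id (coord i p : Cn R n).
have [_ dE] := near_eq_differentiable nE did.
apply: (etrans (congr1 (fun f : Cn R n -> Cn R n => f h) dE)).
exact: (congr1 (fun f : Cn R n -> Cn R n => f h) dE0).
Qed.

(** The whole family of components generated by the component [b] in chart [i]. The value 0 is the
    convention of [tangent_at] for charts that miss [p]. *)
Definition chart_tangent p i (b : Cn R n) (j : I) : 'rV[R[i]]_n :=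
  if pselect (dom j p) then 'd (transition i j) (coord i p : Cn R n) b else 0.

Lemma chart_tangentP p i b : dom i p -> tangent_at p (chart_tangent p i b).
Proof.
move=> ip; split=> [j k jp kp|j jp]; rewrite /chart_tangent; last first.
  by case: pselect.
case: (pselect (dom k p)) => // kp'; case: (pselect (dom j p)) => // jp'.
exact: (diff_transition_comp b ip jp kp).
Qed.

Lemma chart_tangent_id p i b : dom i p -> chart_tangent p i b i = b.
Proof.
by move=> ip; rewrite /chart_tangent; case: pselect => // ip'; exact:
  diff_transition_id.
Qed.

Lemma tangent_bundle_eq (T : Type) (A : atlas R n T) (X Y : tangent_bundle A) :
  tpt X = tpt Y -> tcomp X = tcomp Y -> X = Y.
Proof.
case: X => x v tv; case: Y => y w tw /= xy vw.
move: tw; rewrite -xy -vw => tw.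
by congr TangentVector; exact: Prop_irrelevance.
Qed.

(** One component determines those in all charts around the point, and the others are fixed to 0. *)
Lemma TM_eq i (X Y : TM M) : dom i (tpt X) -> tpt X = tpt Y ->
  tcomp X i = tcomp Y i -> X = Y.
Proof.
move=> iX XY vXY; apply: tangent_bundle_eq => //; apply/funext => j.
have [tX zX] := tangentP X; have [tY zY] := tangentP Y.
have [jX|jX] := pselect (dom j (tpt X)).
  by rewrite (tX i j iX jX) (tY i j) -?XY // vXY.
by rewrite zX // zY -?XY.
Qed.

Lemma is_zeroP i (X : TM M) : dom i (tpt X) -> is_zero X <-> tcomp X i = 0.
Proof.
move=> iX; split=> [->//|Xi0 j].
have [tX zX] := tangentP X.
have [jX|jX] := pselect (dom j (tpt X)); last exact: zX.
by rewrite (tX i j iX jX) Xi0 /differential linear0.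
Qed.

End Transition.

Section TangentCharts.
Context {R : realType} {n : nat} {M : complex_manifold R n}.
Local Notation I := (idx (charts M)).
Local Notation TA := (tangent_atlas (charts M)).
Implicit Types (i j k : I) (p q : M) (X : TM M).

Definition tangent_coord i X : Cn R (n + n) := row_mx (coord i (tpt X))
  (tcomp X i).

Definition tangent_transition i j : Cn R (n + n) -> Cn R (n + n) :=
  @localize R (n + n) _ TA _ i (tangent_coord j).

Lemma tangent_coord_inj i X Y : dom i (tpt X) -> dom i (tpt Y) ->
  tangent_coord i X = tangent_coord i Y -> X = Y.
Proof.
move=> iX iY /eq_row_mx[cXY vXY].
by apply: (TM_eq iX) => //; exact: coord_injP cXY.
Qed.

Lemma localize_tangentE (Y : zmodType) i (f : TM M -> Y) X : dom i (tpt X) ->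
  @localize R (n + n) _ TA _ i f (tangent_coord i X) = f X.
Proof.
move=> iX; rewrite (@localizeE R (n + n) _ TA _ i f X) // => Z iZ ZX.
by congr f; exact: tangent_coord_inj ZX.
Qed.

(** A chart of TM fills the product of the chart image in M, here [overlap i i], with the full
    fibre. *)
Lemma tangent_coord_surj i (y : Cn R (n + n)) : overlap i i (lsubmx y) ->
  exists X, dom i (tpt X) /\ tangent_coord i X = y.
Proof.
move=> [p [ip _] py].
exists (TangentVector (chart_tangentP (rsubmx y) ip)); split=> //.
by rewrite /tangent_coord /= chart_tangent_id // py hsubmxK.
Qed.

Lemma lsubmx_continuous (m k : nat) : continuous (lsubmx : Cn R (m + k) ->
  Cn R m).
Proof. by move=> x; exact: differentiable_continuous (differentiable_lsubmx
  x). Qed.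

Lemma rsubmx_continuous (m k : nat) : continuous (rsubmx : Cn R (m + k) ->
  Cn R k).
Proof. by move=> x; exact: differentiable_continuous (differentiable_rsubmx
  x). Qed.

Lemma lsubmx_overlap_open i j : open [set y : Cn R (n + n) | overlap i j
  (lsubmx y)].
Proof.
apply: (@open_comp (Cn R (n + n)) (Cn R n) lsubmx).
  by move=> y _; exact: lsubmx_continuous.
exact: overlap_open.
Qed.

Definition nonzero_image i : set (Cn R (n + n)) :=
  @coord R (n + n) _ TA i @` (@dom R (n + n) _ TA i `&` [set X | ~ is_zero X]).

Lemma open_neq0 (m : nat) : open [set v : Cn R m | v != 0].
Proof.
have -> : [set v : Cn R m | v != 0] = ~` [set 0].
  by apply/seteqP; split=> v /= /eqP.
apply: closed_openC; apply: accessible_closed_set1; apply: hausdorff_accessible.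
exact: norm_hausdorff.
Qed.

Lemma nonzero_image_open i : open (nonzero_image i).
Proof.
have -> : nonzero_image i =
    [set y : Cn R (n + n) | overlap i i (lsubmx y)] `&` (rsubmx : Cn R (n + n)
      -> Cn R n) @^-1` [set v | v != 0].
  apply/seteqP; split=>
    [_ [X [/= iX X0] <-]|y [/= /tangent_coord_surj[X [iX Xy]] y0]].
    split=> /=; first by rewrite row_mxKl; exact: overlap_coord.
    by rewrite row_mxKr; apply/negP => /eqP Xi0; apply: X0; apply/(is_zeroP iX).
  exists X => //; split=> //= /(is_zeroP iX) Xi0.
  by move: y0; rewrite -Xy row_mxKr Xi0 eqxx.
apply: openI; first exact: lsubmx_overlap_open.
apply: (@open_comp (Cn R (n + n)) (Cn R n) rsubmx); last exact: open_neq0.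
by move=> y _; exact: rsubmx_continuous.
Qed.

Lemma tangent_transitionE i j (y : Cn R (n + n)) : overlap i j (lsubmx y) ->
  tangent_transition i j y =
  row_mx (transition i j (lsubmx y)) ('d (transition i j) (lsubmx y : Cn R n)
    (rsubmx y)).
Proof.
move=> [p [ip jp] py].
have [X [iX Xy]] : exists X, dom i (tpt X) /\ tangent_coord i X = y.
  by apply: tangent_coord_surj; rewrite -py; exact: overlap_coord.
have Xp : tpt X = p.
  apply: (@coord_injP _ _ _ i) => //.
  by rewrite py -Xy row_mxKl.
rewrite -Xy /tangent_transition localize_tangentE // /tangent_coord row_mxKl
  row_mxKr.
rewrite transitionE //; congr row_mx.
by have [tX _] := tangentP X; rewrite (tX i j) // Xp.
Qed.

Lemma tangent_transition_differentiable i j (y : Cn R (n + n)) : overlap i j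
  (lsubmx y) ->
  differentiable (tangent_transition i j) y.
Proof.
move=> yij.
have hol := @transition_holomorphic _ _ M i j.
(* The fibre block depends on the base point and on the vector together. Expanding the vector in the
   standard basis leaves products of a coordinate with a derivative in a fixed direction, which
   [holomorphic_differentiable_diff] covers. *)
have nE : \forall x \near y,
    row_mx (transition i j (lsubmx x)) (\sum_k rsubmx x 0 k *:
      'd (transition i j) (lsubmx x : Cn R n) 'e_k)
    = tangent_transition i j x.
  apply: filterS (open_nbhs_nbhs (conj (@lsubmx_overlap_open i j) yij))
    => x xij.
  rewrite tangent_transitionE //; congr row_mx.
  by rewrite {2}[rsubmx x]row_sum_delta linear_sum; apply: eq_bigr => k _;
    rewrite linearZ.
suff df : differentiable (fun x : Cn R (n + n) =>
  row_mx (transition i j (lsubmx x))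
    (\sum_k rsubmx x 0 k *: 'd (transition i j) (lsubmx x : Cn R n) 'e_k) : Cn R
      (n + n)) y.
  by have [] := near_eq_differentiable nE df.
have dl : differentiable (lsubmx : Cn R (n + n) -> Cn R n) y :=
  differentiable_lsubmx y.
have dr : differentiable (rsubmx : Cn R (n + n) -> Cn R n) y :=
  differentiable_rsubmx y.
apply: differentiable_row => a; case: (split_ordP a) => b ->.
  under eq_fun do rewrite row_mxEl.
  have dt : differentiable (transition i j) (lsubmx y : Cn R n) by have [+ _] :=
    hol; apply.
  exact: (differentiable_comp (differentiable_comp dl dt) (differentiable_coord
    _ 0 b)).
under eq_fun do rewrite row_mxEr summxE.
have -> : (fun x : Cn R (n + n) => \sum_k (rsubmx x 0 k *: 'd (transition i j)
  (lsubmx x : Cn R n) 'e_k) 0 b : R[i]^o)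
   = \sum_k (fun x : Cn R (n + n) =>
     (rsubmx x 0 k *: 'd (transition i j) (lsubmx x : Cn R n) 'e_k) 0
     b : R[i]^o).
  by rewrite fct_sumE.
apply: differentiable_sum => k.
under eq_fun do rewrite mxE.
apply: differentiableM.
  exact: (differentiable_comp dr (differentiable_coord _ 0 k)).
have dd := holomorphic_differentiable_diff (row_frame n) 'e_k
  (@overlap_open _ _ M i j) hol yij.
exact: (differentiable_comp (differentiable_comp dl dd) (differentiable_coord
  _ 0 b)).
Qed.

End TangentCharts.

Lemma differentiable_row_mx (K : numFieldType) (V : normedModType K) m k
    (f : V -> 'rV[K]_m) (g : V -> 'rV[K]_k) (x : V) :
  differentiable f x -> differentiable g x ->
  differentiable (fun y => row_mx (f y) (g y)) x /\
  forall h, 'd (fun y => row_mx (f y) (g y)) x h = row_mx ('d f x h) ('d g x h).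
Proof.
move=> df dg.
have dF : differentiable (fun y => row_mx (f y) (g y)) x.
  apply: differentiable_row => a; case: (split_ordP a) => b ->.
    under eq_fun do rewrite row_mxEl.
    exact: (differentiable_comp df (differentiable_coord _ 0 b)).
  under eq_fun do rewrite row_mxEr.
  exact: (differentiable_comp dg (differentiable_coord _ 0 b)).
split=> // h; rewrite -[LHS]hsubmxK; congr row_mx.
  have cl : continuous (lsubmx : 'rV[K]_(m + k) -> 'rV[K]_m).
    by move=> y; exact: differentiable_continuous (differentiable_lsubmx y).
  have := diff_comp dF (differentiable_lsubmx (row_mx (f x) (g x))).
  rewrite diff_lin // => /(congr1 (fun F : V -> _ => F h)) /= <-.
  by congr ('d _ x h); apply/funext => y; rewrite /= row_mxKl.
have cr : continuous (rsubmx : 'rV[K]_(m + k) -> 'rV[K]_k).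
  by move=> y; exact: differentiable_continuous (differentiable_rsubmx y).
have := diff_comp dF (differentiable_rsubmx (row_mx (f x) (g x))).
rewrite diff_lin // => /(congr1 (fun F : V -> _ => F h)) /= <-.
by congr ('d _ x h); apply/funext => y; rewrite /= row_mxKr.
Qed.

(** [smooth] asks for all orders, so the order lost by differentiating is harmless. *)
Lemma holomorphic_diff (R : realType) (V : normedModType R[i]) N (E : frame V N)
    m (U : set V) (f : V -> 'rV[R[i]]_m) b : open U ->
  holomorphic U f -> holomorphic U (fun y => 'd f y b).
Proof.
move=> oU hf; split=> [x Ux|j]; first exact:
  (holomorphic_differentiable_diff E b oU hf Ux).
have [df sf] := hf; have [sP sQ] := sf j.
split=> k.
  apply: (eq_Ck oU _ (Ck_rderive b (sP k.+1))) => x Ux.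
  by rewrite (diff_ReIm b j (df x Ux)).
apply: (eq_Ck oU _ (Ck_rderive b (sQ k.+1))) => x Ux.
by rewrite (diff_ReIm b j (df x Ux)).
Qed.

(** * Holomorphic discs and their lifts *)

Section Disc.
Context {R : realType} {n : nat} {M : complex_manifold R n}.
Local Notation I := (idx (charts M)).
Local Notation TA := (tangent_atlas (charts M)).
Context {phi : R[i]^o -> M} (hphi : holomorphic_disc phi).
Implicit Types (i j k : I) (w : R[i]^o).

Definition disc_dom i : set R[i]^o := @unit_disc R `&` phi @^-1` dom i.

Definition disc_coord i : R[i]^o -> Cn R n := coord i \o phi.

Definition disc_velocity i w : Cn R n := 'd (disc_coord i) w 1.

Lemma unit_disc_open : open (@unit_disc R).
Proof.
have -> : @unit_disc R = ball (0 : R[i]^o) 1.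
  by apply/seteqP; split=> w; rewrite /unit_disc /ball /= sub0r normrN.
exact: ball_open.
Qed.

Lemma disc_dom_open i : open (disc_dom i).
Proof.
rewrite openE => w [w1 wi]; apply: filterI.
  exact: open_nbhs_nbhs (conj unit_disc_open w1).
have [cphi _] := hphi; apply: (cphi w w1).
exact: open_nbhs_nbhs (conj (@dom_open _ _ M i) wi).
Qed.

Lemma disc_coord_holomorphic i : holomorphic (disc_dom i) (disc_coord i).
Proof. by have [_ +] := hphi; apply. Qed.

Lemma disc_coord_differentiable i w : disc_dom i w ->
  differentiable (disc_coord i) w.
Proof. by have [+ _] := disc_coord_holomorphic i; apply. Qed.

Lemma disc_velocity_holomorphic i : holomorphic (disc_dom i) (disc_velocity i).
Proof.
exact: (holomorphic_diff scalar_frame 1 (@disc_dom_open i)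
  (disc_coord_holomorphic i)).
Qed.

Lemma disc_velocity_transition i j w : disc_dom i w -> disc_dom j w ->
  disc_velocity j w = 'd (transition i j) (disc_coord i w) (disc_velocity i w).
Proof.
move=> iw jw.
have dc := disc_coord_differentiable iw.
have dt : differentiable (transition i j) (disc_coord i w).
  by apply: transition_differentiable; [case: iw|case: jw].
have nE : \forall z \near w, (transition i j \o disc_coord i) z =
  disc_coord j z.
  apply: filterS (open_nbhs_nbhs (conj (@disc_dom_open i) iw)) => z [_ iz].
  by rewrite /= /disc_coord /= transitionE.
have [_ dE] := near_eq_differentiable nE (differentiable_comp dc dt).
apply: (etrans (congr1 (fun f : R[i]^o -> Cn R n => f 1) dE)).
exact: (congr1 (fun f : R[i]^o -> Cn R n => f 1) (diff_comp dc dt)).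
Qed.

Lemma is_velocityP w (X : TM M) : unit_disc w ->
  is_velocity phi w X <->
  tpt X = phi w /\ forall i, dom i (phi w) -> tcomp X i = disc_velocity i w.
Proof.
move=> w1; split=> -[Xw vX]; split=> // i iw; rewrite vX //.
  by apply: derive1E'; exact: disc_coord_differentiable (conj w1 iw).
by apply/esym/derive1E'; exact: disc_coord_differentiable (conj w1 iw).
Qed.

Lemma velocity_exists w : unit_disc w -> exists X : TM M, is_velocity phi w X.
Proof.
move=> w1; have [i iw] := dom_cover (phi w).
exists (TangentVector (chart_tangentP (disc_velocity i w) iw)).
apply/(is_velocityP _ w1); split=> //= j jw.
have := disc_velocity_transition (conj w1 iw) (conj w1 jw).
by move=> ->; rewrite /chart_tangent; case: pselect.
Qed.

Lemma pullbackE (G : TM M -> R) w (X : TM M) : unit_disc w ->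
  is_velocity phi w X ->
  pullback G phi w = G X.
Proof.
move=> w1 vX; rewrite /pullback; case: xgetP => [y _ [Y vY <-]|/(_ (G X))[]];
  last by exists X.
have [Xw cX] := (is_velocityP X w1).1 vX; have [Yw cY] :=
  (is_velocityP Y w1).1 vY.
have [i iw] := dom_cover (phi w).
by congr G; apply: (@TM_eq _ _ _ i); rewrite ?Yw ?Xw ?cX ?cY.
Qed.

Definition disc_lift (l : R[i]) i w : Cn R (n + n) :=
  row_mx (disc_coord i w) (l^-1 *: disc_velocity i w).

Lemma disc_liftE l i w (X : TM M) : disc_dom i w -> is_velocity phi w X ->
  tangent_coord i (tscale l^-1 X) = disc_lift l i w.
Proof.
move=> [w1 iw] /(is_velocityP X w1)[Xw cX].
by rewrite /tangent_coord /disc_lift /= Xw cX.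
Qed.

Lemma disc_lift_diff l i w : disc_dom i w ->
  differentiable (disc_lift l i) w /\
  forall h, 'd (disc_lift l i) w h = row_mx ('d (disc_coord i) w h) (l^-1 *:
    'd (disc_velocity i) w h).
Proof.
move=> iw; have dc := disc_coord_differentiable iw.
have [+ _] := disc_velocity_holomorphic i => /(_ _ iw) dv.
have ds : differentiable (fun z => l^-1 *: disc_velocity i z) w by exact:
  differentiableZ.
have [dF dE] := differentiable_row_mx dc ds.
split=> // h; rewrite [LHS]dE; congr row_mx.
exact: (diff_scaled dv).
Qed.

Lemma disc_lift_diff2 l i w h : disc_dom i w ->
  differentiable (fun z => 'd (disc_lift l i) z h) w.
Proof.
move=> iw.
have nE : \forall z \near w,
    (row_mx ('d (disc_coord i) z h) (l^-1 *: 'd (disc_velocity i) z h) : Cn R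
      (n + n)) = 'd (disc_lift l i) z h.
  apply: filterS (open_nbhs_nbhs (conj (@disc_dom_open i) iw)) => z iz.
  by have [_ ->] := disc_lift_diff l iz.
have hc := holomorphic_differentiable_diff scalar_frame h (@disc_dom_open i)
  (disc_coord_holomorphic i) iw.
have hv := holomorphic_differentiable_diff scalar_frame h (@disc_dom_open i)
  (disc_velocity_holomorphic i) iw.
have hs : differentiable (fun z => l^-1 *: 'd (disc_velocity i) z h) w by exact:
  differentiableZ.
have [dF _] := differentiable_row_mx hc hs.
by have [] := near_eq_differentiable nE dF.
Qed.

(** The transformation rule that makes the derivative of the lift a tangent vector of TM. *)
Lemma disc_lift_transition l i j w : disc_dom i w -> disc_dom j w ->
  'd (disc_lift l j) w 1 = 'd (tangent_transition i j) (disc_lift l i w)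
    ('d (disc_lift l i) w 1).
Proof.
move=> iw jw.
have [dc _] := disc_lift_diff l iw.
have oc : overlap i j (lsubmx (disc_lift l i w)).
  by rewrite row_mxKl; apply: overlap_coord; [case: iw|case: jw].
have dt := tangent_transition_differentiable oc.
have nE : \forall z \near w, (tangent_transition i j \o disc_lift l i) z =
  disc_lift l j z.
  have nij : nbhs w (disc_dom i `&` disc_dom j).
    by apply: open_nbhs_nbhs; split=> //; apply: openI; exact: disc_dom_open.
  apply: filterS nij => z [iz jz]; have [z1 _] := iz.
  have [X vX] := velocity_exists z1.
  rewrite /= -(disc_liftE l iz vX) -(disc_liftE l jz vX) /tangent_transition
    localize_tangentE //=.
  by have [-> _] := (is_velocityP X z1).1 vX; case: iz.
have [_ dE] := near_eq_differentiable nE (differentiable_comp dc dt).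
apply: (etrans (congr1 (fun f : R[i]^o -> Cn R (n + n) => f 1) dE)).
exact: (congr1 (fun f : R[i]^o -> Cn R (n + n) => f 1) (diff_comp dc dt)).
Qed.

End Disc.

(** * Logarithms of Finsler metrics in charts *)

Section Finsler.
Context {R : realType} {n : nat} {M : complex_manifold R n}.
Local Notation TA := (tangent_atlas (charts M)).
Implicit Types (G : TM M -> R) (p q : TM M).

Definition sqnorm (l : R[i]) : R := complex.Re l ^+ 2 + complex.Im l ^+ 2.

Lemma sqnormE l : (sqnorm l)%:C = `|l| ^+ 2.
Proof. exact: add_Re2_Im2. Qed.

Lemma sqnorm_gt0 l : l != 0 -> 0 < sqnorm l.
Proof. by move=> l0; rewrite -ltcR sqnormE exprn_gt0 // normr_gt0. Qed.

Lemma finslerZ G l p : complex_finsler G -> G (tscale l p) = sqnorm l * G p.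
Proof.
move=> hG; apply: (@complexI R).
by rewrite (finsler_homogeneous hG) rmorphM /= sqnormE.
Qed.

Lemma finsler_gt0 G p : complex_finsler G -> ~ is_zero p -> 0 < G p.
Proof.
move=> hG p0; rewrite lt_neqAle (finsler_ge0 hG) andbT eq_sym.
by apply/eqP => /(finsler_eq0 hG).
Qed.

Lemma tscaleK l p : l != 0 -> tscale l^-1 (tscale l p) = p.
Proof.
move=> l0; apply: tangent_bundle_eq => //; apply/funext => i.
by rewrite /= scalerA mulVf // scale1r.
Qed.

Lemma tscaleVK l p : l != 0 -> tscale l (tscale l^-1 p) = p.
Proof.
move=> l0; apply: tangent_bundle_eq => //; apply/funext => i.
by rewrite /= scalerA mulfV // scale1r.
Qed.

(** [r] will be the squared modulus of l, kept inside the logarithm so that composing with the lift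
    gives ln (phi^* G) exactly. *)
Definition log_chart (i : idx (charts M)) (r : R) G (y : Cn R (n + n)) : R :=
  ln (r * @localize R (n + n) _ TA _ i G y).

Lemma log_chart_smooth i r G k : complex_finsler G -> 0 < r ->
  Ck k (nonzero_image i) (log_chart i r G).
Proof.
move=> hG r0; apply: Ck_ln; first exact: nonzero_image_open.
  move=> _ [p [ip p0] <-]; rewrite (localize_tangentE _ ip).
  by rewrite mulr_gt0 // finsler_gt0.
apply: CkM; [exact: nonzero_image_open|exact: Ck_cst|].
exact: (finsler_smooth hG).
Qed.

Lemma log_chartE i r G p : dom i (tpt p) -> log_chart i r G (tangent_coord i p)
  = ln (r * G p).
Proof. by move=> ip; rewrite /log_chart localize_tangentE. Qed.

End Finsler.

(** * Curvature along a disc and the lifted tangent vector *)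

Section DiscThrough.
Context {R : realType} {n : nat} {M : complex_manifold R n}.
Local Notation TA := (tangent_atlas (charts M)).
Context {p : TM M} (hp : ~ is_zero p) {phi : R[i]^o -> M}
  (hphi : holomorphic_disc phi).
Context (phi0 : phi 0 = tpt p) {l : R[i]} (l0 : l != 0)
  (vphi : is_velocity phi 0 (tscale l p)).
Implicit Types (i j : idx (charts M)) (G : TM M -> R).

Let disc0 : @unit_disc R 0.
Proof. by rewrite /unit_disc /= normr0. Qed.

Let dom0 i : dom i (tpt p) -> disc_dom (phi := phi) i 0.
Proof. by move=> ip; split=> //=; rewrite phi0. Qed.

Lemma disc_lift0 i : dom i (tpt p) -> disc_lift (phi := phi) l i 0 =
  tangent_coord i p.
Proof. by move=> ip; rewrite -(disc_liftE hphi l (dom0 ip) vphi) tscaleK. Qed.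

Lemma nonzero_image_base i : dom i (tpt p) ->
  nonzero_image i (tangent_coord i p).
Proof. by move=> ip; exists p. Qed.

(** The equality holds on the whole of [disc_dom i], zeros of phi' included, because both sides are
    the logarithm of the same number. *)
Lemma near_pullback G i : complex_finsler G -> dom i (tpt p) ->
  \forall w \near (0 : R[i]^o),
    ln (pullback G phi w) = log_chart i (sqnorm l) G
      (disc_lift (phi := phi) l i w).
Proof.
move=> hG ip; apply:
  filterS (open_nbhs_nbhs (conj (@disc_dom_open _ _ _ _ hphi i) (dom0 ip)))
  => w iw.
have [w1 _] := iw; have [X vX] := velocity_exists hphi w1.
have iX : dom i (tpt (tscale l^-1 X)).
  by have [-> _] := (is_velocityP hphi X w1).1 vX; case: iw.
rewrite (pullbackE hphi G w1 vX) -(disc_liftE hphi l iw vX) log_chartE //.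
by rewrite -finslerZ // tscaleVK.
Qed.

(** [levi_chain] along the lift in the direction 1. The denominator is the value of [G] at phi'(0) =
    l v, by homogeneity. *)
Lemma gauss_curvatureE G i : complex_finsler G -> dom i (tpt p) ->
  gauss_curvature (pullback G phi) 0 =
  - (2 / (sqnorm l * G p)) *
    levi_coord (log_chart i (sqnorm l) G) (tangent_coord i p)
      ('d (disc_lift (phi := phi) l i) 0 1).
Proof.
move=> hG ip; rewrite /gauss_curvature (pullbackE hphi G disc0 vphi)
  finslerZ //.
congr (_ * _); rewrite (near_eq_wirt_wirtbar (1 : R[i]^o) (1 : R[i]^o)
  (near_pullback hG ip)).
have C2 := log_chart_smooth i 2 hG (sqnorm_gt0 l0).
rewrite -disc_lift0 //.
apply: (levi_chain _ (@nonzero_image_open _ _ M i) C2).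
- by rewrite disc_lift0 //; exact: nonzero_image_base.
- apply: filterS (open_nbhs_nbhs (conj (@disc_dom_open _ _ _ _ hphi i)
  (dom0 ip))) => w iw.
  by have [] := disc_lift_diff hphi l iw.
- by move=> k; exact: disc_lift_diff2 (dom0 ip).
Qed.

Definition lift_tangent i : 'rV[R[i]]_(n + n) :=
  if pselect (dom i (tpt p)) then l^-1 *: 'd (disc_lift (phi := phi) l i) 0
    1 else 0.

Lemma lift_tangentE i : dom i (tpt p) ->
  lift_tangent i = l^-1 *: 'd (disc_lift (phi := phi) l i) 0 1.
Proof. by move=> ip; rewrite /lift_tangent; case: pselect. Qed.

Lemma lift_tangentP : @tangent_at R (n + n) _ TA p lift_tangent.
Proof.
split=> [i j ip jp|i ip]; last by rewrite /lift_tangent; case: pselect.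
apply: (etrans (lift_tangentE jp)).
apply: (etrans (congr1 (fun z => l^-1 *: z) (disc_lift_transition hphi l
  (dom0 ip) (dom0 jp)))).
apply/esym; apply: (etrans (f_equal2 (fun a b => 'd (tangent_transition i j)
  (a : Cn R (n + n)) b)
  (esym (disc_lift0 ip)) (lift_tangentE ip))).
exact: linearZZ.
Qed.

Definition lift_vector : TTM M := TangentVector lift_tangentP.

Lemma lsubmx_lift_tangent i : dom i (tpt p) -> lsubmx (lift_tangent i) =
  tcomp p i.
Proof.
move=> ip; rewrite lift_tangentE // (disc_lift_diff hphi l (dom0 ip)).2
  scale_row_mx row_mxKl.
have [_ cX] := (is_velocityP hphi _ disc0).1 vphi.
have ip0 : dom i (phi 0) by rewrite phi0.
by rewrite -[X in _ *: X]/(disc_velocity i 0) -(cX i ip0) /= scalerA mulVf //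
  scale1r.
Qed.

Lemma lift_vector_pushforward : is_pushforward (fun q : TM M => tpt q)
  lift_vector p.
Proof.
split=> // i j /= ip jp.
have oc : overlap i j (lsubmx (tangent_coord i p)) by rewrite row_mxKl; exact:
  overlap_coord.
have dl : differentiable (lsubmx : Cn R (n + n) -> Cn R n)
  (tangent_coord i p) :=
  differentiable_lsubmx _.
have dt : differentiable (transition i j) (lsubmx (tangent_coord i p) : Cn R n).
  by rewrite row_mxKl; exact: transition_differentiable.
(* Read in charts, the projection of TM keeps the left block and then changes coordinates on M. *)
have nE : \forall y \near (tangent_coord i p : Cn R (n + n)),
    (transition i j \o lsubmx) y = @localize R (n + n) _ TA _ i
      (coord j \o (fun q : TM M => tpt q)) y.
  apply: filterS (open_nbhs_nbhs (conj (@lsubmx_overlap_open _ _ M i j) oc)) =>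
    y [z [iz jz] zy].
  have [q [iq qy]] : exists q : TM M, @dom _ _ _ (charts M) i (tpt q) /\
    tangent_coord i q = y.
    by apply: tangent_coord_surj; exists z; first by split.
  rewrite -qy localize_tangentE //= row_mxKl; exact: transitionE.
have [_ dE] := near_eq_differentiable nE (differentiable_comp dl dt).
apply/esym; apply: (etrans (congr1 (fun f : Cn R (n + n) -> Cn R n =>
  f (lift_tangent i)) dE)).
apply: (etrans (congr1 (fun f : Cn R (n + n) -> Cn R n => f (lift_tangent i))
  (diff_comp dl dt))).
have dlE := diff_lin (tangent_coord i p) (@lsubmx_continuous R n n).
have E2 : 'd (lsubmx : Cn R (n + n) -> Cn R n) (tangent_coord i p)
  (lift_tangent i) = tcomp p i.
  apply: (etrans (congr1 (fun f : Cn R (n + n) -> Cn R n =>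
    f (lift_tangent i)) dlE)).
  exact: lsubmx_lift_tangent.
have E3 : lsubmx (tangent_coord i p) = @coord _ _ _ (charts M) i (tpt p) by
  rewrite row_mxKl.
apply: (etrans (f_equal2 (fun a b => 'd (transition i j) (a : Cn R n) b)
  E3 E2)).
by have [tX _] := tangentP p; exact/esym/(tX i j).
Qed.

(* The disc computes the Levi form to the same value in every chart, so the
   chart independence of [levi] is not needed. *)
Lemma levi_lift_vector G1 G2 : complex_finsler G1 -> complex_finsler G2 ->
  levi (fun q : TM M => ln (G1 q / G2 q)) lift_vector =
  (G2 p * gauss_curvature (pullback G2 phi) 0 - G1 p * gauss_curvature
    (pullback G1 phi) 0) / 2.
Proof.
move=> hG1 hG2.
have G1p := finsler_gt0 hG1 hp; have G2p := finsler_gt0 hG2 hp.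
have r0 := sqnorm_gt0 l0.
set v := (X in _ = X).
have main i : dom i (tpt p) ->
    levi_coord (@localize R (n + n) _ TA _ i (fun q : TM M => ln (G1 q / G2 q)))
      (tangent_coord i p) (lift_tangent i) = v.
  move=> ip; rewrite /v !(gauss_curvatureE _ ip) //.
  (* Dividing c'(0) by l divides the Levi form by the squared modulus of l, matching the factor in
     [gauss_curvatureE]. *)
  have rV : (sqnorm l)^-1%:C = `|l^-1| ^+ 2 by rewrite fmorphV /=
    sqnormE normfV exprVn.
  rewrite lift_tangentE // (levi_coordZ _ _ _ rV).
  have oW := @nonzero_image_open _ _ M i.
  have Wp := nonzero_image_base ip.
  have nE : \forall y \near tangent_coord i p,
      @localize R (n + n) _ TA _ i (fun q : TM M => ln (G1 q / G2 q)) y =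
      log_chart i (sqnorm l) G1 y - log_chart i (sqnorm l) G2 y.
    apply: filterS (open_nbhs_nbhs (conj oW Wp)) => _ [q [iq q0] <-].
    have G1q := finsler_gt0 hG1 q0; have G2q := finsler_gt0 hG2 q0.
    rewrite (localize_tangentE _ iq) !(log_chartE _ _ iq).
    rewrite !lnM ?posrE ?invr_gt0 // lnV ?posrE //.
    by ring.
  rewrite (near_eq_levi_coord _ nE).
  rewrite (levi_coordB _ oW (log_chart_smooth i 2 hG1 r0) (log_chart_smooth i 2
    hG2 r0) Wp).
  move: (levi_coord _ _ _) (levi_coord _ _ _) => L1 L2.
  by field; rewrite !gt_eqF.
(* Whichever chart [xget] selects gives [v]; its default is excluded because some chart contains the
   base point. *)
rewrite /levi; case: xgetP => [y _ [i ip <-]|]; first exact: main.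
have [i ip] := dom_cover (tpt p).
by move=> /(_ v)[]; exists i => //; exact: main.
Qed.

End DiscThrough.

(* Passage to the suprema *)
Local Close Scope complex_scope.

Theorem proposition0p1 (R : realType) (n : nat) (M : complex_manifold R n)
    (G1 G2 : TM M -> R) (hG1 : complex_finsler G1) (hG2 : complex_finsler G2)
    (p : TM M) (hp : ~ is_zero p) :
  (hol_sect_curvature G2 p +? - ((G1 p / G2 p)%:E * hol_sect_curvature G1 p)
   ->
   hol_sect_curvature G2 p - (G1 p / G2 p)%:E * hol_sect_curvature G1 p
   <= (2 / G2 p)%:E *
      ereal_sup [set (levi (fun q : TM M => ln (G1 q / G2 q)) X)%:E
                | X in [set X : TTM M |
                         tpt X = p /\
                         is_pushforward (fun q : TM M => tpt q) X p]])%E.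
Proof.
have G1p := finsler_gt0 hG1 hp; have G2p := finsler_gt0 hG2 hp.
have c0 : 0 < G1 p / G2 p by rewrite divr_gt0.
have a0 : 0 < 2 / G2 p by rewrite divr_gt0.
set L := ereal_sup _ => Kdef.
(* The curvature of [G1] is a real number on each disc and stands on the right, so the bound makes
   sense even when [L] is infinite. *)
have disc_le phi : holomorphic_disc_through p phi ->
    ((gauss_curvature (pullback G2 phi) 0)%:E <=
     (2 / G2 p)%:E * L + (G1 p / G2 p * gauss_curvature (pullback G1 phi)
       0)%:E)%E.
  move=> [hphi phi0 [l l0 vphi]].
  have levi_le : ((levi (fun q : TM M => ln (G1 q / G2 q))
    (lift_vector hphi phi0 l0 vphi))%:E <= L)%E.
    apply: ereal_sup_ubound; exists (lift_vector hphi phi0 l0 vphi) => //;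
      split=> //.
    exact: lift_vector_pushforward.
  move: levi_le; rewrite levi_lift_vector // => levi_le.
  rewrite -leeBlDr //; apply: le_trans (lee_wpmul2l _ levi_le);
    last by rewrite lee_fin ltW.
  rewrite -EFinB -EFinM lee_fin le_eqVlt; apply/orP; left; apply/eqP.
  move: (G1 p) (G2 p) G2p (gauss_curvature _ _) (gauss_curvature _ _) =>
    g1 g2 g2p k1 k2.
  by field; rewrite gt_eqF.
case K1E : (hol_sect_curvature G1 p) Kdef => [k| |] Kdef.
- rewrite -EFinM leeBlDr //; apply: ge_ereal_sup => _ [phi dphi <-].
  apply: (le_trans (disc_le phi dphi)); apply: leeD => //.
  have : ((gauss_curvature (pullback G1 phi) 0)%:E <= k%:E)%E.
    by rewrite -K1E; apply: ereal_sup_ubound; exists phi.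
  by rewrite !lee_fin => kphi; rewrite ler_wpM2l // ltW.
(* If the supremum for [G1] is +oo, the left-hand side is -oo. *)
- by rewrite gt0_muley ?lte_fin // addeNy leNye.
(* A supremum of real numbers is -oo only over the empty set. Without discs the supremum for [G2] is
   -oo as well, and the difference has the form excluded by [Kdef]. *)
- have no_disc phi : ~ holomorphic_disc_through p phi.
    move=> dphi; have : ((gauss_curvature (pullback G1 phi) 0)%:E <=
      hol_sect_curvature G1 p)%E.
      by apply: ereal_sup_ubound; exists phi.
    by rewrite K1E leeNy_eq.
  have K2E : hol_sect_curvature G2 p = -oo%E.
    apply/eqP; rewrite -leeNy_eq; apply: ge_ereal_sup => _ [phi dphi <-].
    by case: (no_disc phi).
  by move: Kdef; rewrite K2E gt0_muleNy ?lte_fin.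
Qed.
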